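(* Let $u\in X_p$ be the solution of the primal weak problem, $z\in X_d$ the solution of the adjoint weak problem, $\gamma=\mathcal J_p(u)$, and for $(w,v)\in X_p\times X_d$ let $\gamma_0(w,v):=m(w)+\ell(v)-a(w,v)$. Then for every $(w,v)\in X_p\times X_d$, $$\gamma-\gamma_0(w,v)=a(u-w,z-v).$$ Consequently, $$|\gamma-\gamma_0(w,v)|\le C_{\rm con}\|u-w\|_1\|z-v\|_1,$$ where $C_{\rm con}$ is any constant such that $|a(t,s)|\le C_{\rm con}\|t\|_1\|s\|_1$ for all $t,s\in H^1(\Omega)$.
   Context: Domain and coefficients: $\Omega\subset\mathbb R^d$, $d\ge2$, is a bounded Lipschitz domain with outward unit normal $n$ and $\partial\Omega=\overline{\Gamma_D}\cup\overline{\Gamma_N}$, where $\Gamma_D,\Gamma_N$ are disjoint relatively open subsets of $\partial\Omega$ and $|\Gamma_D|>0$. $A\in L^\infty(\Omega;\mathbb R^{d\times d})$ is symmetric with $a_0|\xi|^2\le\xi^TA(x)\xi\le a_1|\xi|^2$ for all $\xi\in\mathbb R^d$ and a.e. $x$, where $0<a_0\le a_1<\infty$; $b\in L^\infty(\Omega)^d$, $c\in L^\infty(\Omega)$. Data: $f_1,g_1\in L^2(\Omega)$, $f_2,g_2\in L^2(\Omega)^d$, $\psi_p,\psi_d\in L^2(\Gamma_N)$, $\phi_p,\phi_d\in H^{1/2}(\Gamma_D)$ (restrictions to $\Gamma_D$ of $H^{1/2}(\partial\Omega)$ functions). Notation: $(\cdot,\cdot)$ and $\|\cdot\|_0$ are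 the $L^2(\Omega)$ inner product and norm, $\|\cdot\|_1$ is the $H^1(\Omega)$ norm, $\langle\cdot,\cdot\rangle_{\Gamma_N}$ is the $L^2(\Gamma_N)$ pairing of traces. $H_D^1(\Omega)=\{v\in H^1(\Omega):v=0\text{ on }\Gamma_D\}$, $X_p=\{w\in H^1(\Omega):w=\phi_p\text{ on }\Gamma_D\}$, $X_d=\{v\in H^1(\Omega):v=\phi_d\text{ on }\Gamma_D\}$. For $t,s,w\in H^1(\Omega)$, $a(t,s)=(A\nabla t,\nabla s)+(b\cdot\nabla t+ct,s)$, $\ell(s)=(f_1,s)-(f_2,\nabla s)-\langle\psi_p,s\rangle_{\Gamma_N}$, $m(w)=(g_1,w)-(g_2,\nabla w)-\langle\psi_d,w\rangle_{\Gamma_N}$. Standing assumption (inf-sup): there is $\beta>0$ with $\beta=\inf_{0\ne w_0\in H_D^1(\Omega)}\sup_{0\ne v_0\in H_D^1(\Omega)}\frac{a(w_0,v_0)}{\|w_0\|_1\|v_0\|_1}=\inf_{0\ne v_0\in H_D^1(\Omega)}\sup_{0\ne w_0\in H_D^1(\Omega)}\frac{a(w_0,v_0)}{\|w_0\|_1\|v_0\|_1}$. Primal weak problem: find $u\in X_p$ with $a(u,s_0)=\ell(s_0)$ for all $s_0\in H_D^1(\Omega)$. Adjoint weak problem: find $z\in X_d$ with $a(s_0,z)=m(s_0)$ for all $s_0\in H_D^1(\Omega)$. Quantity of interest: with $\sigma:=-A\nabla u-f_2\in H(\mathrm{div};\Omega)$ (so $\nabla\cdot\sigma=f_1-b\cdot\nabla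 u-cu$), $\mathcal J_p(u)=(g_1,u)-(g_2,\nabla u)-\langle\psi_d,u\rangle_{\Gamma_N}-\langle(A\nabla u+f_2)\cdot n,\phi_d\rangle_{\Gamma_D}$, where the last term equals $\langle\sigma\cdot n,\phi_d\rangle_{\Gamma_D}:=(\sigma,\nabla z_d)+(\nabla\cdot\sigma,z_d)-\langle\psi_p,z_d\rangle_{\Gamma_N}$ for any $z_d\in H^1(\Omega)$ with $z_d=\phi_d$ on $\Gamma_D$ (independent of the choice of $z_d$ by the primal weak equation). $\gamma:=\mathcal J_p(u)$. *)

(* Defs.v *)
From HB Require Import structures.
From mathcomp Require Import all_boot all_order all_algebra.
From mathcomp Require Import all_classical all_reals all_analysis.

Set Implicit Arguments.
Unset Strict Implicit.
Unset Printing Implicit Defensive.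

Import Order.TTheory GRing.Theory Num.Theory.
Import numFieldNormedType.Exports.

Local Open Scope classical_set_scope.
Local Open Scope ring_scope.

(* The norm carried by 'rV[R]_d in the library is the sup norm. It is used
   below only for topological notions; all metric quantities are Euclidean. *)
Section euclidean.
Context {R : realType} {d : nat}.
Implicit Types x y : 'rV[R]_d.

Definition dot x y : R := \sum_(i < d) x 0 i * y 0 i.
Definition enorm x : R := Num.sqrt (dot x x).
Definition ebasis (i : 'I_d) : 'rV[R]_d := delta_mx 0 i.
(* the product of a matrix with a column vector, vectors being stored as rows *)
Definition matvec (M : 'M[R]_d) x : 'rV[R]_d := (M *m x^T)^T.

Definition ediam (X : set 'rV[R]_d) : \bar R :=
  ereal_sup [set (enorm (p.1 - p.2))%:E | p in X `*` X].

Definition box x y : set 'rV[R]_d := [set p | forall i, x 0 i <= p 0 i <= y 0 i].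

End euclidean.

Section outer_measures.
Context (R : realType) (d : nat).
Local Open Scope ereal_scope.

(* In this copy of R^d every subset is measurable, so that mu_ext below is the
   infimum over all countable covers. *)
Let E := g_sigma_algebraType [set: set 'rV[R]_d].

(* the least volume of a box that contains X, and +oo if X is unbounded *)
Definition box_gauge (X : set E) : \bar R :=
  if X == set0 then 0 else
  ereal_inf [set (\prod_(i < d) (p.2 0 i - p.1 0 i)%R)%:E | p in
    [set p : 'rV[R]_d * 'rV[R]_d | X `<=` box p.1 p.2]].

Definition lebesgue_outer (X : set 'rV[R]_d) : \bar R := mu_ext box_gauge X.

(* volume of the unit ball of R^k, by the recursion
   omega_(k+2) = 2 pi / (k+2) * omega_k *)
Fixpoint unit_ball_volume (k : nat) : R :=
  match k with
  | 0 => 1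
  | 1 => 2
  | j.+2 => 2 * pi / (j.+2)%:R * unit_ball_volume j
  end%R.

Definition diam_gauge (k : nat) (delta : R) (X : set E) : \bar R :=
  if X == set0 then 0 else
  if ediam X <= delta%:E
  then (unit_ball_volume k * (fine (ediam X) / 2) ^+ k)%:E else +oo.

(* k-dimensional Hausdorff measure *)
Definition hausdorff_outer (k : nat) (X : set 'rV[R]_d) : \bar R :=
  ereal_sup [set mu_ext (diam_gauge k delta) X | delta in [set t : R | (0 < t)%R]].

Lemma box_gauge0 : box_gauge set0 = 0.
Proof. by rewrite /box_gauge eqxx. Qed.

Lemma box_gauge_ge0 X : 0 <= box_gauge X.
Proof.
rewrite /box_gauge; case: eqVneq => // /set0P[x Xx].
apply: le_ereal_inf_tmp => _ [p /= Xp <-]; rewrite lee_fin.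
apply: prodr_ge0 => i _; rewrite subr_ge0.
by have /andP[] := Xp _ Xx i; exact: le_trans.
Qed.

Lemma unit_ball_volume_ge0 k : (0 <= unit_ball_volume k)%R.
Proof.
suff: (0 <= unit_ball_volume k)%R && (0 <= unit_ball_volume k.+1)%R.
  by case/andP.
elim: k => [|k /andP[k0 k1]]; first by rewrite /= ler01 ler0n.
by rewrite k1 /= mulr_ge0// divr_ge0// mulr_ge0// pi_ge0.
Qed.

Lemma ediam_ge0 (X : set 'rV[R]_d) : X !=set0 -> 0 <= ediam X.
Proof.
move=> [x Xx]; apply: ereal_sup_ubound; exists (x, x) => //=.
rewrite subrr /enorm /dot big1 ?sqrtr0// => i _.
by rewrite mxE mulr0.
Qed.

Lemma diam_gauge0 k delta : diam_gauge k delta set0 = 0.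
Proof. by rewrite /diam_gauge eqxx. Qed.

Lemma diam_gauge_ge0 k delta X : 0 <= diam_gauge k delta X.
Proof.
rewrite /diam_gauge; case: eqVneq => // /set0P X0; case: ifPn => // _.
rewrite lee_fin mulr_ge0 ?unit_ball_volume_ge0// exprn_ge0// divr_ge0//.
by rewrite fine_ge0// ediam_ge0.
Qed.

Lemma lebesgue_outer_sigma_subadditive : sigma_subadditive lebesgue_outer.
Proof. exact: mu_ext_sigma_subadditive box_gauge_ge0. Qed.

HB.instance Definition _ := isOuterMeasure.Build R 'rV[R]_d lebesgue_outer
  (mu_ext0 box_gauge0 box_gauge_ge0) (mu_ext_ge0 box_gauge_ge0)
  (@le_mu_ext _ _ _ box_gauge) lebesgue_outer_sigma_subadditive.

Section hausdorff.
Variable k : nat.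

Let pre delta := @mu_ext _ E R (diam_gauge k delta).
Let pre_ge0 delta X : 0 <= pre delta X.
Proof. exact: mu_ext_ge0 (@diam_gauge_ge0 k delta) X. Qed.

Lemma hausdorff_outer0 : hausdorff_outer k set0 = 0.
Proof.
rewrite /hausdorff_outer (_ : [set _ | _ in _] = [set 0]) ?ereal_sup1//.
apply/seteqP; split=> [_ [t _ <-]|_ ->]; last exists 1%R => //=.
all: exact: (mu_ext0 (diam_gauge0 k _) (@diam_gauge_ge0 k _)).
Qed.

Lemma hausdorff_outer_ge0 X : 0 <= hausdorff_outer k X.
Proof.
apply: (@le_trans _ _ (pre 1%R X)); first exact: pre_ge0.
by apply: ereal_sup_ubound; exists 1%R => //=.
Qed.

Lemma le_hausdorff_outer :
  {homo hausdorff_outer k : X Y / X `<=` Y >-> X <= Y}.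
Proof.
move=> X Y XY; apply: ge_ereal_sup => _ [t t0 <-].
apply: (@le_trans _ _ (pre t Y)); first exact: le_mu_ext.
by apply: ereal_sup_ubound; exists t.
Qed.

Lemma hausdorff_outer_sigma_subadditive :
  sigma_subadditive (hausdorff_outer k).
Proof.
move=> F; apply: ge_ereal_sup => _ [t t0 <-].
apply: (le_trans (mu_ext_sigma_subadditive (@diam_gauge_ge0 k t) F)).
apply: lee_nneseries => [i _ _|i _]; first exact: pre_ge0.
by apply: ereal_sup_ubound; exists t.
Qed.

HB.instance Definition _ := isOuterMeasure.Build R 'rV[R]_d (hausdorff_outer k)
  hausdorff_outer0 hausdorff_outer_ge0 le_hausdorff_outer
  hausdorff_outer_sigma_subadditive.

End hausdorff.

Let leb : {outer_measure set 'rV[R]_d -> \bar R} := lebesgue_outer.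
(* d.-1 : the ambient dimension d is positive wherever this is used *)
Let haus : {outer_measure set 'rV[R]_d -> \bar R} := hausdorff_outer d.-1.

(* Both are measures on their Caratheodory sigma-algebras. *)
Definition volume : {measure set (caratheodory_type leb) -> \bar R} := leb.
Definition surface : {measure set (caratheodory_type haus) -> \bar R} := haus.

End outer_measures.

Arguments volume {R d}.
Arguments surface {R d}.

Section lebesgue_spaces.
Context {dd : measure_display} {T : measurableType dd} {R : realType}.
Variables (mu : {measure set T -> \bar R}) (D : set T).

Definition L2 (f : T -> R) : Prop :=
  measurable_fun D f /\ (\int[mu]_(x in D) ((f x) ^+ 2)%:E < +oo)%E.

Definition Linfty (f : T -> R) : Prop :=
  measurable_fun D f /\
  exists M : R, {ae mu, forall x, D x -> `|f x| <= M}.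

Definition cvg_L2 (f_ : nat -> T -> R) (f : T -> R) : Prop :=
  (fun k => \int[mu]_(x in D) ((f_ k x - f x) ^+ 2)%:E)%E @ \oo --> 0%E.

Definition pairing (f g : T -> R) : R := \int[mu]_(x in D) (f x * g x).

End lebesgue_spaces.

Section calculus.
Context {R : realType} {d : nat}.
Implicit Types (Omega : set 'rV[R]_d) (phi : 'rV[R]_d -> R).

Fixpoint class_C (k : nat) phi : Prop :=
  continuous phi /\
  if k is j.+1 then forall i : 'I_d,
    (forall x, derivable phi x (ebasis i)) /\ class_C j ('D_(ebasis i) phi)
  else True.

Definition smooth phi : Prop := forall k, class_C k phi.

Definition test_function Omega phi : Prop :=
  smooth phi /\ exists K : set 'rV[R]_d,
    [/\ compact K, K `<=` Omega & forall x, ~ K x -> phi x = 0].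

Definition weak_partial Omega (i : 'I_d) (f g : 'rV[R]_d -> R) : Prop :=
  forall phi, test_function Omega phi ->
  pairing volume Omega f ('D_(ebasis i) phi) = - pairing volume Omega g phi.

(* inner product of L^2(Omega)^d *)
Definition vpairing Omega (F G : 'rV[R]_d -> 'rV[R]_d) : R :=
  \int[volume]_(x in Omega) dot (F x) (G x).

Definition L2v Omega (F : 'rV[R]_d -> 'rV[R]_d) : Prop :=
  forall i, L2 volume Omega (fun x => F x 0 i).

Definition Linftyv Omega (F : 'rV[R]_d -> 'rV[R]_d) : Prop :=
  forall i, Linfty volume Omega (fun x => F x 0 i).

Definition Linftym Omega (F : 'rV[R]_d -> 'M[R]_d) : Prop :=
  forall i j, Linfty volume Omega (fun x => F x i j).

Definition gradient phi (x : 'rV[R]_d) : 'rV[R]_d :=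
  \row_i 'D_(ebasis i) phi x.

(* s is an element of H(div; Omega) and g is its weak divergence *)
Definition weak_divergence Omega (s : 'rV[R]_d -> 'rV[R]_d)
    (g : 'rV[R]_d -> R) : Prop :=
  [/\ L2v Omega s, L2 volume Omega g & forall phi, test_function Omega phi ->
    vpairing Omega s (gradient phi) = - pairing volume Omega g phi].

End calculus.

Section domains.
Context {R : realType} {d : nat}.
Implicit Types Omega : set 'rV[R]_d.

Definition boundary Omega : set 'rV[R]_d := closure Omega `\` interior Omega.

(* Near each boundary point, Omega is the part strictly above the graph of a
   Lipschitz function in some orthonormal coordinate system: e is the unit
   vector of the vertical axis, and y - <y, e> e stands for the d - 1
   horizontal coordinates of y. *)
Definition lipschitz_boundary Omega : Prop :=
  forall x, boundary Omega x ->
  exists (r : R) (e : 'rV[R]_d) (g : 'rV[R]_d -> R) (L : R),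
  [/\ 0 < r, enorm e = 1,
      forall y z, `|g y - g z| <= L * enorm (y - z) &
      forall y, enorm (y - x) < r ->
        (Omega y <-> g (y - dot y e *: e) < dot y e)].

Definition bounded_lipschitz_domain Omega : Prop :=
  [/\ open Omega, connected Omega, Omega !=set0, bounded_set Omega &
      lipschitz_boundary Omega].

Definition relatively_open (S G : set 'rV[R]_d) : Prop :=
  exists2 U : set 'rV[R]_d, open U & G = U `&` S.

Definition boundary_partition Omega (GD GN : set 'rV[R]_d) : Prop :=
  [/\ relatively_open (boundary Omega) GD, relatively_open (boundary Omega) GN,
      GD `&` GN = set0, boundary Omega = closure GD `|` closure GN &
      (0 < surface GD)%E].

(* H^(1/2)(boundary Omega), with the Sobolev-Slobodeckij seminorm; the exponent
   d is (d - 1) + 2 * (1/2), and the quotient is 0 for x = y. *)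
Definition Hhalf Omega (g : 'rV[R]_d -> R) : Prop :=
  L2 surface (boundary Omega) g /\
  (\int[surface]_(x in boundary Omega) \int[surface]_(y in boundary Omega)
     ((g x - g y) ^+ 2 / enorm (x - y) ^+ d)%:E < +oo)%E.

Definition Hhalf_on Omega (G : set 'rV[R]_d) (phi : 'rV[R]_d -> R) : Prop :=
  exists2 g, Hhalf Omega g & {ae surface, forall x, G x -> phi x = g x}.

End domains.

Section sobolev.
Context {R : realType} {d : nat}.

(* An element of H^1(Omega) is handled through representatives of the function,
   of its weak gradient and of its trace, which the function determines up to
   null sets. Being a product of function spaces, this type comes with its
   pointwise linear structure. The values outside Omega, resp. outside the
   boundary of Omega, are irrelevant. *)
Definition sobolev : Type :=
  (('rV[R]_d -> R) * ('rV[R]_d -> 'rV[R]_d) * ('rV[R]_d -> R))%type.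

Definition fval (u : sobolev) : 'rV[R]_d -> R := u.1.1.
Definition grad (u : sobolev) : 'rV[R]_d -> 'rV[R]_d := u.1.2.
Definition trace (u : sobolev) : 'rV[R]_d -> R := u.2.

Implicit Types (Omega : set 'rV[R]_d) (u : sobolev).

(* The trace operator of a bounded Lipschitz domain is the continuous extension
   to H^1(Omega) of the restriction of smooth functions to the boundary. *)
Definition has_trace Omega u : Prop :=
  L2 surface (boundary Omega) (trace u) /\
  exists phi : nat -> 'rV[R]_d -> R,
  [/\ forall k, smooth (phi k),
      cvg_L2 volume Omega phi (fval u),
      forall i, cvg_L2 volume Omega (fun k => 'D_(ebasis i) (phi k))
                                    (fun x => grad u x 0 i) &
      cvg_L2 surface (boundary Omega) phi (trace u)].

Definition H1 Omega : set sobolev := [set u |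
  [/\ L2 volume Omega (fval u),
      L2v Omega (grad u),
      forall i, weak_partial Omega i (fval u) (fun x => grad u x 0 i) &
      has_trace Omega u]].

Definition norm1 Omega u : R :=
  Num.sqrt (pairing volume Omega (fval u) (fval u) +
            vpairing Omega (grad u) (grad u)).

(* the affine space of the u in H^1(Omega) that equal phi on G *)
Definition H1_with_trace Omega (G : set 'rV[R]_d) (phi : 'rV[R]_d -> R) :
    set sobolev :=
  H1 Omega `&` [set u | {ae surface, forall x, G x -> trace u x = phi x}].

Definition H1D Omega (GD : set 'rV[R]_d) : set sobolev :=
  H1_with_trace Omega GD (fun=> 0).

Definition nonzero Omega u : Prop :=
  ~ {ae volume, forall x, Omega x -> fval u x = 0}.

End sobolev.

Arguments sobolev : clear implicits.

Section forms.
Context {R : realType} {d : nat}.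
Variable Omega : set 'rV[R]_d.

Definition elliptic (A : 'rV[R]_d -> 'M[R]_d) (a0 a1 : R) : Prop :=
  {ae volume, forall x, Omega x -> (A x)^T = A x /\
    forall xi : 'rV[R]_d,
      a0 * enorm xi ^+ 2 <= dot xi (matvec (A x) xi) <= a1 * enorm xi ^+ 2}.

Definition bform (A : 'rV[R]_d -> 'M[R]_d) (b : 'rV[R]_d -> 'rV[R]_d)
    (c : 'rV[R]_d -> R) (t s : sobolev R d) : R :=
  vpairing Omega (fun x => matvec (A x) (grad t x)) (grad s) +
  pairing volume Omega (fun x => dot (b x) (grad t x) + c x * fval t x) (fval s).

(* l is lform with data (f1, f2, psi_p), m is lform with data (g1, g2, psi_d) *)
Definition lform (GN : set 'rV[R]_d) (f1 : 'rV[R]_d -> R)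
    (f2 : 'rV[R]_d -> 'rV[R]_d) (psi : 'rV[R]_d -> R) (s : sobolev R d) : R :=
  pairing volume Omega f1 (fval s) - vpairing Omega f2 (grad s)
  - pairing surface GN psi (trace s).

Definition inf_sup (GD : set 'rV[R]_d)
    (a : sobolev R d -> sobolev R d -> R) (beta : R) : Prop :=
  let V := [set w | H1D Omega GD w /\ nonzero Omega w] in
  let q w v := (a w v / (norm1 Omega w * norm1 Omega v))%:E in
  [/\ 0 < beta,
      beta%:E = ereal_inf [set ereal_sup [set q w v | v in V] | w in V] &
      beta%:E = ereal_inf [set ereal_sup [set q w v | w in V] | v in V]].

Definition flux (A : 'rV[R]_d -> 'M[R]_d) (f2 : 'rV[R]_d -> 'rV[R]_d)
    (u : sobolev R d) (x : 'rV[R]_d) : 'rV[R]_d :=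
  - matvec (A x) (grad u x) - f2 x.

(* <s . n, phi_d> on the Dirichlet part, where div_s is the weak divergence of s
   and zd is a lifting of phi_d *)
Definition normal_flux (GN : set 'rV[R]_d) (psi : 'rV[R]_d -> R)
    (s : 'rV[R]_d -> 'rV[R]_d) (div_s : 'rV[R]_d -> R) (zd : sobolev R d) : R :=
  vpairing Omega s (grad zd) + pairing volume Omega div_s (fval zd)
  - pairing surface GN psi (trace zd).

End forms.

(* Main.v *)
(* By the primal equation
   [l(s) - a(u, s)] takes the same value at every [s] of [X_d], and the normal
   flux is this value at [z_d]; inserting it in [gamma] leaves
   [m(u - w) - a(u - w, v)], and [m(u - w) = a(u - w, z)] by the adjoint
   equation. The identification of the normal flux needs
   [div sigma = f_1 - b . grad u - c u], which is only known against test
   functions. It is transported to [z_d] without any density theorem: [z_d] is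
   an [L^2] limit of functions smooth on the whole space, and a smooth function
   times cutoffs converging to the indicator of Omega is a sequence
   of test functions, to which dominated convergence applies. That a test
   function is an element of [H^1], i.e. integration by parts, is the
   invariance of the outer Lebesgue measure under translations, applied to
   difference quotients. *)

Require Import Defs.
From mathcomp Require Import all_boot all_order all_algebra.
From mathcomp Require Import all_classical all_reals all_analysis.
From mathcomp Require Import measurable_realfun ring lra.

Set Implicit Arguments.
Unset Strict Implicit.
Unset Printing Implicit Defensive.

Import Order.TTheory GRing.Theory Num.Theory.
Import numFieldNormedType.Exports.

Local Open Scope classical_set_scope.
Local Open Scope ring_scope.

(** Both measures are restrictions of outer measures to their Caratheodory sigma-algebras, known
    only through infima over covers. Splitting an integral into a sum needs measurable domains and
    integrands, so it has to be established first, for Lebesgue and Hausdorff measure alike, that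
    open sets are Caratheodory measurable. [volume] is never identified with a product measure, so
    integration by parts cannot go through Fubini; this is why translations enter. What has to be
    moved from test functions to [zd] is the orthogonality of a single L^2 function, with no
    gradient in it. Hence L^2 approximation of [zd] by values is enough, and although the
    derivatives of the cutoffs are unbounded in general, no limit of them is ever taken. *)

(** * Caratheodory measurability of open sets for Lebesgue and Hausdorff measure *)

Section rational_boxes.
Context {R : realType} {d : nat}.
Implicit Types (x y : 'rV[R]_d) (U : set 'rV[R]_d).

Definition open_box x y : set 'rV[R]_d :=
  [set p | forall i, x 0 i < p 0 i < y 0 i].

Definition rat_point (q : 'rV[rat]_d) : 'rV[R]_d := map_mx ratr q.

(** Balls of the sup norm are boxes, so it suffices to pick rational corners on both sides of each
    coordinate. The open boxes exhaust an open set countably; the closed ones will be the compact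
    supports of bump functions. *)
Lemma open_rat_box U x : open U -> U x ->
  exists q : 'rV[rat]_d * 'rV[rat]_d,
    open_box (rat_point q.1) (rat_point q.2) x /\
    box (rat_point q.1) (rat_point q.2) `<=` U.
Proof.
rewrite openE => oU Ux; have /nbhs_ballP[e /= e0 eU] := oU _ Ux.
have lo i : exists q : rat, x 0 i - e < ratr q < x 0 i.
  by have [|q] := @rat_in_itvoo R (x 0 i - e) (x 0 i); [lra|exists q].
have hi i : exists q : rat, x 0 i < ratr q < x 0 i + e.
  by have [|q] := @rat_in_itvoo R (x 0 i) (x 0 i + e); [lra|exists q].
have [l lP] := choice lo; have [h hP] := choice hi.
exists (\row_i l i, \row_i h i); split=> [i|p pb] /=.
  by rewrite !mxE; have := lP i; have := hP i; lra.
apply: eU; split => // j i; rewrite ord1 /ball /= ltr_distl.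
have := pb i; rewrite !mxE /=; have := lP i; have := hP i.
by move=> /andP[h1 h2] /andP[l1 l2] /andP[p1 p2]; apply/andP; split; lra.
Qed.

(** Half-spaces generate the open boxes by sigma-algebra operations, and an open set is a union of
    open boxes with rational corners. This leaves one criterion per measure, about a single
    coordinate. *)
Lemma open_caratheodory (mu : {outer_measure set 'rV[R]_d -> \bar R}) :
  (forall (i : 'I_d) (c : R), mu.-caratheodory [set p | p 0 i <= c]) ->
  forall U, open U -> mu.-caratheodory U.
Proof.
move=> half U oU.
pose T := caratheodory_type mu.
have mle (i : 'I_d) (c : R) : measurable ([set p : 'rV[R]_d | p 0 i <= c] : set T).
  exact: half.
have mgt (i : 'I_d) (c : R) : measurable ([set p : 'rV[R]_d | c < p 0 i] : set T).
  rewrite (_ : [set _ | _] = ~` [set p : 'rV[R]_d | p 0 i <= c]).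
    exact: measurableC.
  by apply/seteqP; split=> p /=; rewrite ltNge => /negP.
have mlt (i : 'I_d) (c : R) : measurable ([set p : 'rV[R]_d | p 0 i < c] : set T).
  rewrite (_ : [set _ | _] = \bigcup_n [set p : 'rV[R]_d | p 0 i <= c - n.+1%:R^-1]).
    by apply: bigcupT_measurable => n; exact: mle.
  apply/seteqP; split=> p /=; last first.
    move=> [n _ /= /le_lt_trans]; apply.
    by rewrite ltrBlDr ltrDl invr_gt0.
  rewrite -subr_gt0 => pc.
  exists (Num.trunc (c - p 0 i)^-1) => //=.
  rewrite lerBrDl -lerBrDr invf_ple ?posrE// ltW//.
  exact: truncnS_gt.
have mob (x y : 'rV[R]_d) : measurable (open_box x y : set T).
  rewrite (_ : open_box _ _ = \big[setI/setT]_(i < d)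
     ([set p : 'rV[R]_d | x 0 i < p 0 i] `&` [set p : 'rV[R]_d | p 0 i < y 0 i])).
    by apply: bigsetI_measurable => i _; apply: measurableI.
  apply/seteqP; split=> p /=.
    by move=> h; elim/big_ind : _ => // i _; have /andP[] := h i.
  by move=> h i; move: h; rewrite (bigD1 i)//= => -[[xp py] _]; apply/andP.
change (measurable (U : set T)).
rewrite (_ : U = \bigcup_q (if `[< box (rat_point q.1) (rat_point q.2) `<=` U >]
    then open_box (rat_point q.1) (rat_point q.2) else set0)).
  apply: countable_bigcupT_measurable => [|q]; first exact: countableP.
  by case: ifP => _ //; exact: mob.
apply/seteqP; split=> [x Ux|x [q _]].
  have [q [qx qU]] := open_rat_box oU Ux.
  by exists q => //; rewrite asboolT.
case: ifPn => // /asboolP qU qx; apply: qU => i.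
by have /andP[? ?] := qx i; apply/andP; split; exact: ltW.
Qed.

End rational_boxes.

Section mu_ext_superadditive.
Context {dd : measure_display} {T : semiRingOfSetsType dd} {R : realType}.
Variable g : set T -> \bar R.
Hypothesis g0 : forall X, (0 <= g X)%E.
Hypothesis mT : forall X : set T, measurable X.

(** A cover of [X] intersected with [A] and with [B] covers both parts, so superadditivity passes
    from the gauge to the outer measure. [mT] makes the intersected covers admissible. [A] and [B]
    are complementary half-spaces for Lebesgue measure and half-spaces at positive distance for
    Hausdorff measure. *)
Lemma mu_ext_superadditive (A B X : set T) :
  (forall F, (g (F `&` A) + g (F `&` B) <= g F)%E) ->
  (mu_ext g (X `&` A) + mu_ext g (X `&` B) <= mu_ext g X)%E.
Proof.
move=> gAB; apply: le_ereal_inf_tmp => _ [F [mF XF] <-].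
apply: (@le_trans _ _
  (\sum_(k <oo) (g (F k `&` A) + g (F k `&` B)))%E); last first.
  by apply: lee_nneseries => // k _; rewrite adde_ge0.
rewrite nneseriesD//; apply: leeD; apply: ereal_inf_lbound.
- exists (fun k => F k `&` A) => //; split=> // x [/XF[k _ Fx] Ax].
  by exists k.
- exists (fun k => F k `&` B) => //; split=> // x [/XF[k _ Fx] Bx].
  by exists k.
Qed.

End mu_ext_superadditive.

(* Caratheodory's criterion for a sublevel set: the part of [X] above level
   [c] is exhausted by the sets [c + 1/(n+1) <= f], and the layers between two
   consecutive ones have summable outer measure, because every other layer
   is separated from the previous ones. *)
Section metric_outer_measure.
Context {T : Type} {R : realType}.
Variable mu : {outer_measure set T -> \bar R}.
Variable f : T -> R.
Hypothesis separated : forall (a b : R) (X : set T), a < b ->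
  (mu (X `&` [set x | (f x <= a)%R]) + mu (X `&` [set x | (b <= f x)%R]) <= mu X)%E.

Lemma separated_caratheodory (c : R) : mu.-caratheodory [set x | f x <= c].
Proof.
apply: le_caratheodory_measurable => X.
have [muX|] := ltP (mu X) +oo%E; last by rewrite leye_eq => /eqP ->; rewrite leey.
pose r n : R := c + n.+1%:R^-1.
have rS n : r n.+1 < r n.
  by rewrite /r ltrD2l ltf_pV2 ?posrE// ltr_nat.
have rle m n : (m <= n)%N -> r n <= r m.
  by move=> mn; rewrite /r lerD2l lef_pV2 ?posrE// ler_nat ltnS.
have rc n : c < r n by rewrite /r ltrDl invr_gt0.
pose S k := X `&` [set x | r k.+1 <= f x < r k].
pose up n := X `&` [set x | r n <= f x].
have disj n (p : bool) : (\sum_(0 <= k < n | odd k == p) mu (S k) <= mu X)%E.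
  (* The induction keeps the lower edge of the last layer that was summed: the layers so far lie
     above it, and the next layer of the same parity lies below it with a whole skipped layer in
     between, so [separated] applies. *)
  suff H : (\sum_(0 <= k < n | odd k == p) mu (S k) <=
     mu (up (if (odd n == p) then n.-1 else n)))%E.
    by apply: (le_trans H); apply: le_outer_measure => x [].
  elim: n => [|n IH].
    by rewrite big_geq// outer_measure_ge0.
  rewrite big_mkcond big_nat_recr//= -big_mkcond /=.
  case: (eqVneq (odd n) p) IH => [op|op]; last first.
    have -> : (~~ odd n == p) by move: op; case: (odd n); case: (p).
    by move=> IH; rewrite adde0.
  have -> : (~~ odd n == p) = false by rewrite -op; case: (odd n).
  case: n op => [|n] op IH.
    rewrite big_geq// add0e; apply: le_outer_measure => x [Xx /andP[] //].
  apply: le_trans (separated (up n.+2) (rS n)).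
  rewrite addeC; apply: leeD.
    apply: le_outer_measure => x [Xx /= /andP[h1 h2]]; split => //=.
    exact: ltW.
  apply: (le_trans IH); apply: le_outer_measure => x [Xx /= h1].
  split; last exact: h1.
  by split=> //=; apply: le_trans h1; apply: rle; rewrite leqW.
have Soo : (\sum_(0 <= k <oo) mu (S k) < +oo)%E.
  apply: (@le_lt_trans _ _ (mu X + mu X)%E); last by rewrite lte_add_pinfty.
  apply: lime_le; first by apply: is_cvg_nneseries => *; exact: outer_measure_ge0.
  near=> n; rewrite (bigID (fun k => odd k == true))/=.
  apply: leeD; first exact: disj.
  rewrite (eq_bigl (fun k => odd k == false)); first exact: disj.
  by move=> k; case: (odd k).
(* The part above [c] is [up n], which is separated from the sublevel set, together with the layers
   of index at least [n], whose total tends to 0. *)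
have tail n : (mu (X `&` [set x | (f x <= c)%R]) + mu (X `&` ~` [set x | (f x <= c)%R]) <=
     mu X + \sum_(n <= k <oo) mu (S k))%E.
  apply: le_trans (leeD2r _ (separated X (rc n))).
  rewrite -addeA leeD2l//.
  rewrite -nneseries_addn; last by move=> i; exact: outer_measure_ge0.
  apply: (@le_trans _ _ (mu (up n `|` \bigcup_k S (k + n)%N))); last first.
    apply: (le_trans (outer_measureU2 mu _ _)); apply: leeD.
      by apply: le_outer_measure => x [].
    exact: outer_measure_sigma_subadditive.
  apply: le_outer_measure => x [Xx /= /negP]; rewrite -ltNge => cf.
  have [rf|fr] := leP (r n) (f x); first by left.
  right.
  have ex : exists m, r m <= f x.
    exists (Num.trunc (f x - c)^-1).
    rewrite /r -lerBrDl invf_ple ?posrE ?subr_gt0// ltW//.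
    exact: truncnS_gt.
  (* With [m] the first level not above [f x], the point lies in the layer [m.-1]. *)
  have := @ex_minnP _ ex; case: ex_minnP => m rm mmin _.
  have nm : (n < m)%N.
    by rewrite ltnNge; apply/negP => /rle; rewrite leNgt (le_lt_trans rm fr).
  have m0 : (0 < m)%N by exact: leq_ltn_trans nm.
  exists (m.-1 - n)%N => //; split => //=.
  have -> : (m.-1 - n + n = m.-1)%N by apply: subnK; rewrite -ltnS prednK.
  rewrite prednK// rm /= ltNge; apply/negP => /mmin.
  by rewrite leqNgt prednK// leqnn.
apply/lee_addgt0Pr => e e0.
have := nneseries_tail_cvg Soo (fun k _ => outer_measure_ge0 mu (S k)).
move=> /fine_cvgP[] fin /cvgrPdist_lt /(_ _ e0) lte.
near \oo => n.
apply: (le_trans (tail n)); rewrite leeD2l//.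
have finn : (\sum_(n <= k <oo) mu (S k))%E \is a fin_num by near: n.
rewrite -(fineK finn) lee_fin.
have : `|0 - fine (\sum_(n <= k <oo) mu (S k))%E| < e by near: n.
rewrite sub0r normrN => /ltW; apply: le_trans; exact: ler_norm.
Unshelve. all: by end_near. Qed.

End metric_outer_measure.

Section gauges.
Context {R : realType} {d : nat}.
Implicit Types (x y : 'rV[R]_d) (F X : set 'rV[R]_d).

Lemma box_gauge_le F x y : (forall i, x 0 i <= y 0 i) -> F `<=` box x y ->
  (box_gauge F <= (\prod_(i < d) (y 0 i - x 0 i))%:E)%E.
Proof.
move=> xy Fxy; rewrite /box_gauge; case: ifP => _; last first.
  by apply: ereal_inf_lbound; exists (x, y).
by rewrite lee_fin; apply: prodr_ge0 => i _; rewrite subr_ge0.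
Qed.

(** The plane cuts a box around [F] into two boxes of the same total volume. If the plane misses the
    box, one of these would have a side of negative length; then one part of [F] is empty
    instead. *)
Lemma box_gauge_halfspace (i : 'I_d) (c : R) F :
  (box_gauge (F `&` [set p | (p 0 i <= c)%R]) +
   box_gauge (F `&` ~` [set p | (p 0 i <= c)%R]) <= box_gauge F)%E.
Proof.
have [->|/set0P[q Fq]] := eqVneq F set0; first by rewrite !set0I box_gauge0 adde0.
rewrite {3}/box_gauge ifF; last by apply/negbTE/set0P; exists q.
apply: le_ereal_inf_tmp => _ [[x y] /= Fxy <-].
have xy j : x 0 j <= y 0 j by have /andP[] := Fxy _ Fq j; exact: le_trans.
have [cx|xc] := ltP c (x 0 i).
  rewrite (_ : F `&` _ = set0).
    rewrite box_gauge0 add0e; apply: box_gauge_le => // p [/Fxy //].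
  apply/seteqP; split=> // p [/Fxy /(_ i) /andP[xp _] /= pc].
  by have := lt_le_trans cx (le_trans xp pc); rewrite ltxx.
have [cy|yc] := ltP c (y 0 i); last first.
  rewrite (_ : F `&` ~` _ = set0).
    rewrite box_gauge0 adde0; apply: box_gauge_le => // p [/Fxy //].
  apply/seteqP; split=> // p [/Fxy /(_ i) /andP[_ py] /= pc].
  by apply: pc; exact: le_trans yc.
pose upd (z : 'rV[R]_d) : 'rV[R]_d := \row_j (if j == i then c else z 0 j).
have up (z : 'rV[R]_d) j : upd z 0 j = if j == i then c else z 0 j by rewrite mxE.
apply: (@le_trans _ _ ((\prod_(j < d) (upd y 0 j - x 0 j))%:E +
                       (\prod_(j < d) (y 0 j - upd x 0 j))%:E)%E).
  apply: leeD; apply: box_gauge_le => [j|p [/Fxy Fp /= pc] j].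
  - by rewrite up; case: eqVneq => [->|].
  - by rewrite up; have := Fp j; case: eqVneq => [->|//]; rewrite pc andbT => /andP[].
  - by rewrite up; case: eqVneq => [->|//]; exact: ltW.
  - rewrite up; have := Fp j; case: eqVneq => [->|//] /andP[_ ->].
    by rewrite andbT; apply/ltW; rewrite ltNge; apply/negP.
rewrite -EFinD lee_fin (bigD1 i)//= [X in _ + X](bigD1 i)//= [leRHS](bigD1 i)//=.
rewrite !up eqxx.
rewrite [X in _ * X + _](eq_bigr (fun j => y 0 j - x 0 j)); last first.
  by move=> j /negbTE; rewrite up => ->.
rewrite [X in _ + _ * X](eq_bigr (fun j => y 0 j - x 0 j)); last first.
  by move=> j /negbTE; rewrite up => ->.
by rewrite -mulrDl addrC subrKA.
Qed.

Let measurable_any (X : set (g_sigma_algebraType [set: set 'rV[R]_d])) :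
  measurable X.
Proof. exact: sub_gen_smallest. Qed.

Lemma open_lebesgue_measurable (U : set 'rV[R]_d) :
  open U -> (@lebesgue_outer R d).-caratheodory U.
Proof.
apply: (@open_caratheodory _ _ (@lebesgue_outer R d)) => i c.
apply: (@le_caratheodory_measurable _ _ (@lebesgue_outer R d)) => X.
apply: mu_ext_superadditive => //; first exact: box_gauge_ge0.
exact: box_gauge_halfspace.
Qed.

Lemma enorm_ge_coord x i : `|x 0 i| <= enorm x.
Proof.
rewrite -sqrtr_sqr ler_wsqrtr// /dot (bigD1 i)//= -expr2 lerDl.
by apply: sumr_ge0 => j _; rewrite -expr2 sqr_ge0.
Qed.

Lemma le_ediam X F : X `<=` F -> (ediam X <= ediam F)%E.
Proof.
move=> XF; apply: ereal_sup_le => _ [[p q] [/= Xp Xq] <-].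
by exists (p, q) => //=; split; apply: XF.
Qed.

Lemma le_diam_gauge k delta X F : X `<=` F ->
  (diam_gauge k delta X <= diam_gauge k delta F)%E.
Proof.
move=> XF; have [->|X0] := eqVneq X set0.
  by rewrite diam_gauge0 diam_gauge_ge0.
have F0 : F != set0.
  by apply: contra_neq X0 => F0; apply/seteqP; split => // x /XF; rewrite F0.
have XFd := le_ediam XF.
rewrite /diam_gauge (negbTE X0) (negbTE F0).
have [Fd|_] := leP (ediam F) delta%:E; last by rewrite leey.
rewrite (le_trans XFd Fd) lee_fin ler_wpM2l ?unit_ball_volume_ge0//.
have eX : (0 <= ediam X)%E by apply: ediam_ge0; exact/set0P.
have eF : (0 <= ediam F)%E by apply: ediam_ge0; exact/set0P.
have finF : ediam F \is a fin_num.
  by rewrite ge0_fin_numE// (le_lt_trans Fd) ?ltry.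
have finX : ediam X \is a fin_num.
  by rewrite ge0_fin_numE// (le_lt_trans XFd) ?ltey_eq ?finF.
rewrite lerXn2r ?nnegrE ?divr_ge0 ?fine_ge0//.
by rewrite ler_pM2r ?invr_gt0//; exact: fine_le.
Qed.

(** A set that meets both half-spaces has diameter above [delta], so its gauge is infinite;
    otherwise one part is empty and monotonicity is enough. *)
Lemma diam_gauge_separated k (delta a b : R) (i : 'I_d) F : delta < b - a ->
  (diam_gauge k delta (F `&` [set p | (p 0 i <= a)%R]) +
   diam_gauge k delta (F `&` [set p | (b <= p 0 i)%R]) <= diam_gauge k delta F)%E.
Proof.
move=> dab.
have [->|/set0P[p [Fp /= pa]]] := eqVneq (F `&` [set p | (p 0 i <= a)%R]) set0.
  by rewrite diam_gauge0 add0e; apply: le_diam_gauge => p [].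
have [->|/set0P[q [Fq /= bq]]] := eqVneq (F `&` [set p | (b <= p 0 i)%R]) set0.
  by rewrite diam_gauge0 adde0; apply: le_diam_gauge => x [].
rewrite [leRHS]/diam_gauge ifF; last by apply/negbTE/set0P; exists p.
rewrite ifF ?leey//; apply/negbTE; rewrite -ltNge.
apply: (@lt_le_trans _ _ (enorm (q - p))%:E).
  rewrite lte_fin; apply: lt_le_trans (enorm_ge_coord _ i).
  by rewrite !mxE; apply: lt_le_trans (ler_norm _); lra.
by apply: ereal_sup_ubound; exists (q, p).
Qed.

Lemma le_mu_ext_diam_gauge k (s t : R) X : s <= t ->
  (mu_ext (@diam_gauge R d k t) X <= mu_ext (@diam_gauge R d k s) X)%E.
Proof.
move=> st; apply: le_ereal_inf_tmp => _ [F FX <-].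
apply: (@le_trans _ _ (\sum_(j <oo) diam_gauge k t (F j))%E).
  by apply: ereal_inf_lbound; exists F.
apply: lee_nneseries => [j _ _|j _]; first exact: diam_gauge_ge0.
rewrite /diam_gauge; case: ifP => // _.
have [Fs|_] := leP (ediam (F j)) s%:E; last by rewrite leey.
by rewrite ifT// (le_trans Fs)// lee_fin.
Qed.

Lemma open_hausdorff_measurable k (U : set 'rV[R]_d) :
  open U -> (@hausdorff_outer R d k).-caratheodory U.
Proof.
apply: (@open_caratheodory _ _ (@hausdorff_outer R d k)) => i c.
apply: (@separated_caratheodory _ _ (@hausdorff_outer R d k)) => a b X ab /=.
set A := X `&` _; set B := X `&` _.
pose h := @hausdorff_outer R d k.
have h0 Y : (0 <= h Y)%E by exact: hausdorff_outer_ge0.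
have pre_ge0 t Y : (0 <= mu_ext (@diam_gauge R d k t) Y)%E.
  exact: mu_ext_ge0 (@diam_gauge_ge0 _ _ k t) Y.
have key s t : 0 < s -> 0 < t ->
    (mu_ext (@diam_gauge R d k s) A + mu_ext (@diam_gauge R d k t) B <= h X)%E.
  (* A common mesh: below [s] and [t], so that both premeasures increase, and strictly below the gap
     [b - a], so that no admissible set meets both sides. *)
  move=> s0 t0; pose e := Num.min (Num.min s t) ((b - a) / 2).
  have e0 : 0 < e by rewrite !lt_min s0 t0 /=; lra.
  have ea : e < b - a by apply: (@le_lt_trans _ _ ((b - a) / 2));
    [rewrite ge_min lexx orbT|lra].
  apply: (@le_trans _ _ (mu_ext (@diam_gauge R d k e) X)); last first.
    by apply: ereal_sup_ubound; exists e.
  apply: (@le_trans _ _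
    (mu_ext (@diam_gauge R d k e) A + mu_ext (@diam_gauge R d k e) B)%E).
    by apply: leeD; apply: le_mu_ext_diam_gauge; rewrite !ge_min lexx ?orbT.
  apply: mu_ext_superadditive => // F; first exact: diam_gauge_ge0.
  exact: diam_gauge_separated.
change (h A + h B <= h X)%E.
have [hX|] := ltP (h X) +oo%E; last by rewrite leye_eq => /eqP ->; rewrite leey.
have finX : h X \is a fin_num by rewrite ge0_fin_numE.
have preB t : 0 < t -> mu_ext (@diam_gauge R d k t) B \is a fin_num.
  move=> t0; rewrite ge0_fin_numE//; apply: le_lt_trans hX.
  by apply: le_trans (key t t t0 t0); rewrite leeDr.
(* The suprema over the two meshes are taken one after the other; each time the other summand, being
   finite, is moved to the right. *)
have hA t : 0 < t -> (h A + mu_ext (@diam_gauge R d k t) B <= h X)%E.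
  move=> t0; rewrite -leeBrDr ?preB//; apply: ge_ereal_sup => _ [s s0 <-].
  by rewrite leeBrDr ?preB//; exact: key.
have finA : h A \is a fin_num.
  rewrite ge0_fin_numE//; apply: le_lt_trans hX.
  by apply: le_trans (hA 1 ltr01); rewrite leeDl.
rewrite addeC -leeBrDr//; apply: ge_ereal_sup => _ [t t0 <-].
by rewrite leeBrDr// addeC; exact: hA.
Qed.

End gauges.

(** * Square-integrable functions and their pairing *)

Section L2_theory.
Context {dd : measure_display} {T : measurableType dd} {R : realType}.
Variables (mu : {measure set T -> \bar R}) (D : set T).
Hypothesis mD : measurable D.
Implicit Types f g h : T -> R.

Let L2 := L2 mu D.
Let pairing := pairing mu D.

Lemma L2_sqr_integrable f : L2 f -> mu.-integrable D (EFin \o (fun x => f x ^+ 2)).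
Proof.
move=> [mf foo]; apply/integrableP; split.
  by apply/measurable_EFinP; exact: measurable_funX.
apply: le_lt_trans foo; rewrite le_eqVlt; apply/orP; left; apply/eqP.
by apply: eq_integral => x _ /=; rewrite ger0_norm// sqr_ge0.
Qed.

Lemma le_sqr_L2 f h : measurable_fun D f -> mu.-integrable D (EFin \o h) ->
  (forall x, D x -> f x ^+ 2 <= h x) -> L2 f.
Proof.
move=> mf ih fh; split => //.
have /integrableP[mh hoo] := ih; apply: le_lt_trans hoo.
apply: ge0_le_integral => // [x _|||x Dx].
- by rewrite lee_fin sqr_ge0.
- by apply/measurable_EFinP; exact: measurable_funX.
- exact: measurableT_comp.
- by rewrite /= lee_fin (le_trans (fh _ Dx))// ler_norm.
Qed.

Lemma L2_cst0 : L2 (fun=> 0).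
Proof. by split => //; rewrite integral0_eq// => x _; rewrite expr0n. Qed.

Lemma L2D f g : L2 f -> L2 g -> L2 (fun x => f x + g x).
Proof.
move=> Lf Lg.
apply: (@le_sqr_L2 _ (fun x => (f x ^+ 2 + g x ^+ 2) + (f x ^+ 2 + g x ^+ 2))).
- by apply: measurable_funD; [have [] := Lf|have [] := Lg].
- have H := integrableD mD (L2_sqr_integrable Lf) (L2_sqr_integrable Lg).
  exact (integrableD mD H H).
- by move=> x _; have := sqr_ge0 (f x - g x); nra.
Qed.

Lemma L2N f : L2 f -> L2 (fun x => - f x).
Proof.
move=> [mf foo]; split; first exact: measurableT_comp.
by under eq_integral do rewrite sqrrN.
Qed.

Lemma L2B f g : L2 f -> L2 g -> L2 (fun x => f x - g x).
Proof. by move=> Lf /L2N; exact: L2D. Qed.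

Lemma L2_sum (I : Type) (r : seq I) (f : I -> T -> R) :
  (forall i, L2 (f i)) -> L2 (fun x => \sum_(i <- r) f i x).
Proof.
move=> Lf; elim: r => [|i r IH].
  by under eq_fun do rewrite big_nil; exact: L2_cst0.
by under eq_fun do rewrite big_cons; exact: L2D.
Qed.

Lemma L2_integrableM f g : L2 f -> L2 g ->
  mu.-integrable D (EFin \o (fun x => f x * g x)).
Proof.
move=> Lf Lg.
have H := integrableD mD (L2_sqr_integrable Lf) (L2_sqr_integrable Lg).
apply: le_integrable H => //.
  by apply/measurable_EFinP; apply: measurable_funM; [have [] := Lf|have [] := Lg].
move=> x _ /=; rewrite lee_fin [leRHS]ger0_norm; last by rewrite addr_ge0 ?sqr_ge0.
rewrite ler_norml; have := sqr_ge0 (f x - g x); have := sqr_ge0 (f x + g x).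
by have := sqr_ge0 (f x); have := sqr_ge0 (g x); nra.
Qed.

Lemma LinftyM_L2 f g : Linfty mu D f -> L2 g -> L2 (fun x => f x * g x).
Proof.
move=> [mf [M fM]] Lg; have [mg goo] := Lg.
have mfg := measurable_funM mf mg; split => //.
have /integrableP[_] : mu.-integrable D (EFin \o (fun x => M ^+ 2 * g x ^+ 2)).
  exact: (integrableZl mD (M ^+ 2) (L2_sqr_integrable Lg)).
apply: le_lt_trans; apply: ae_ge0_le_integral => //.
- by move=> x _; rewrite lee_fin sqr_ge0.
- by apply/measurable_EFinP; exact: measurable_funX.
- apply: measurableT_comp => //; apply/measurable_EFinP.
  by apply: measurable_funM => //; exact: measurable_funX.
apply: filterS fM => x fM Dx /=.
rewrite lee_fin ger0_norm; last by rewrite mulr_ge0 ?sqr_ge0.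
rewrite exprMn ler_wpM2r ?sqr_ge0//.
by rewrite -real_normK ?num_real// lerXn2r ?nnegrE ?fM// (le_trans _ (fM Dx)).
Qed.

Lemma pairingC f g : pairing f g = pairing g f.
Proof. by apply: eq_Rintegral => x _; rewrite mulrC. Qed.

Lemma pairingBl f g h : L2 f -> L2 g -> L2 h ->
  pairing (fun x => f x - g x) h = pairing f h - pairing g h.
Proof.
move=> Lf Lg Lh; rewrite -RintegralB//; try exact: L2_integrableM.
by apply: eq_Rintegral => x _; rewrite mulrBl.
Qed.

Lemma pairing0l g : pairing (fun=> 0) g = 0.
Proof.
rewrite /pairing /Defs.pairing (eq_Rintegral _ (g := fun=> 0)); last first.
  by move=> x _; rewrite mul0r.
by rewrite Rintegral_cst// mul0r.
Qed.

Lemma pairingBr f g h : L2 f -> L2 g -> L2 h ->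
  pairing h (fun x => f x - g x) = pairing h f - pairing h g.
Proof. by move=> Lf Lg Lh; rewrite pairingC pairingBl// !(pairingC _ h). Qed.

Lemma cvg_L2_eq (f_ : nat -> T -> R) f :
  (forall k x, D x -> f_ k x = f x) -> cvg_L2 mu D f_ f.
Proof.
move=> ff; apply: cvg_near_cst; apply: nearW => k.
by apply: integral0_eq => x /ff ->; rewrite subrr expr0n.
Qed.

Lemma cvg_L2B (f_ g_ : nat -> T -> R) f g :
  (forall k, measurable_fun D (f_ k)) -> (forall k, measurable_fun D (g_ k)) ->
  measurable_fun D f -> measurable_fun D g ->
  cvg_L2 mu D f_ f -> cvg_L2 mu D g_ g ->
  cvg_L2 mu D (fun k x => f_ k x - g_ k x) (fun x => f x - g x).
Proof.
move=> mf_ mg_ mf mg Hf Hg.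
pose F k := (\int[mu]_(x in D) ((f_ k x - f x) ^+ 2)%:E)%E.
pose G k := (\int[mu]_(x in D) ((g_ k x - g x) ^+ 2)%:E)%E.
have m2 (p q : T -> R) : measurable_fun D p -> measurable_fun D q ->
    measurable_fun D (fun x => ((p x - q x) ^+ 2)%:E).
  by move=> mp mq; apply/measurable_EFinP/measurable_funX/measurable_funB.
apply: (@squeeze_cvge _ _ _ _ (fun=> 0%E) _ (fun k => (F k + G k) + (F k + G k))%E).
- apply: nearW => k /=; apply/andP; split.
    by apply: integral_ge0 => x _; rewrite lee_fin sqr_ge0.
  rewrite -!ge0_integralD//; try by [move=> x _; rewrite ?adde_ge0 ?lee_fin ?sqr_ge0|
    exact: m2|apply: emeasurable_funD; exact: m2].
  apply: ge0_le_integral => //.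
  + by move=> x _; rewrite lee_fin sqr_ge0.
  + by apply: m2; exact: measurable_funB.
  + by do 2 apply: emeasurable_funD; exact: m2.
  + move=> x _; rewrite -!EFinD lee_fin.
    by have := sqr_ge0 ((f_ k x - f x) + (g_ k x - g x)); nra.
- exact: cvg_cst.
- have FG : (fun k => F k + G k)%E @ \oo --> 0%E.
    by rewrite -[X in _ --> X]adde0; apply: cvgeD.
  by rewrite -[X in _ --> X]adde0; apply: cvgeD.
Qed.

(** Convergence makes the distance to [f] finite for large [k], which puts [f_ k] in L^2. The
    remainder is estimated by a weighted Young inequality. *)
Lemma pairing_cvg_L2_eq0 (f_ : nat -> T -> R) f g :
  (forall k, measurable_fun D (f_ k)) -> L2 f -> L2 g ->
  cvg_L2 mu D f_ f -> (forall k, L2 (f_ k) -> pairing g (f_ k) = 0) ->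
  pairing g f = 0.
Proof.
move=> mf_ Lf Lg cf gf0; apply/eqP; rewrite -normr_eq0 eq_le normr_ge0 andbT.
apply/ler_addgt0Pl => e e0; rewrite addr0.
set G := \int[mu]_(x in D) (g x ^+ 2).
have G0 : 0 <= G by apply: Rintegral_ge0 => x _; exact: sqr_ge0.
(* The weight in [|g y| <= s g^2 + s^-1 y^2]: the first term integrates to at most [e / 2], and the
   second does once the squared distance is below [s * e / 2]. The [+ 1] covers [G = 0]. *)
pose s := e / (2 * (G + 1)).
have s0 : 0 < s by rewrite divr_gt0// mulr_gt0// ltr_wpDl.
have /fine_cvgP[fin /cvgrPdist_lt lim] := cf.
have sep : 0 < s * e / 2 by rewrite divr_gt0// mulr_gt0.
have [k [fink limk]] := filter_ex (filterI fin (lim _ sep)).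
have Lk : L2 (fun x => f_ k x - f x).
  split; first by apply: measurable_funB => //; case: Lf.
  by rewrite ltey_eq fink.
have Lfk : L2 (f_ k).
  have := L2D Lk Lf; congr (L2 _); apply/funext => x; by rewrite subrK.
have -> : pairing g f = - pairing g (fun x => f_ k x - f x).
  by rewrite pairingBr// gf0// sub0r opprK.
rewrite normrN.
apply: (le_trans (le_normr_Rintegral mD (L2_integrableM Lg Lk))).
have Hg := integrableZl mD s (L2_sqr_integrable Lg).
have Hf := integrableZl mD s^-1 (L2_sqr_integrable Lk).
have H := integrableD mD Hg Hf.
apply: (@le_trans _ _ (\int[mu]_(x in D) (s * g x ^+ 2 + s^-1 * (f_ k x - f x) ^+ 2))).
  apply: le_Rintegral => //.
  - exact: integrable_norm (L2_integrableM Lg Lk).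
  - move=> x _; set y := f_ k x - f x.
    have ss : s * s^-1 = 1 by rewrite divff ?gt_eqF.
    have s'0 : 0 < s^-1 by rewrite invr_gt0.
    have h1 := mulr_ge0 (ltW s'0) (sqr_ge0 (s * g x - y)).
    have h2 := mulr_ge0 (ltW s'0) (sqr_ge0 (s * g x + y)).
    have h3 := mulr_ge0 (ltW s0) (sqr_ge0 (g x)).
    have h4 := mulr_ge0 (ltW s'0) (sqr_ge0 y).
    have E z : s^-1 * (s * g x + z) ^+ 2 = s * g x ^+ 2 + 2 * g x * z + s^-1 * z ^+ 2.
      by field; rewrite gt_eqF.
    move: h1 h2; rewrite !E sqrrN ler_norml; lra.
rewrite RintegralD//.
rewrite !RintegralZl//; try exact: L2_sqr_integrable.
apply: (@le_trans _ _ (e / 2 + e / 2)); last by rewrite -splitr.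
apply: lerD.
  have -> : e / 2 = s * (G + 1) by rewrite /s; field; rewrite gt_eqF// ltr_wpDl.
  by rewrite ler_pM2l// lerDl.
rewrite ler_pdivrMl// mulrA.
move: limk; rewrite sub0r normrN => /ltW; apply: le_trans; exact: ler_norm.
Qed.

End L2_theory.

(** * Measurability of continuous functions and of the domains; volume of bounded sets *)

Section measurability.
Context {R : realType} {d : nat}.
Implicit Types (Omega U G D : set 'rV[R]_d) (f : 'rV[R]_d -> R).

Lemma continuous_caratheodory_measurable_fun
    (mu : {outer_measure set 'rV[R]_d -> \bar R})
    (D : set (caratheodory_type mu)) (f : caratheodory_type mu -> R) :
  (forall U : set 'rV[R]_d, open U -> mu.-caratheodory U) ->
  continuous (f : 'rV[R]_d -> R) -> measurable_fun D f.
Proof.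
move=> omu /continuousP cf; apply: measurable_funTS.
apply: (measurability _ (RGenOpens.measurableE R)).
move=> _ [_ [a [b ->] <-]]; rewrite setTI; apply: omu.
exact/cf/interval_open.
Qed.

Lemma open_volume_measurable U : open U ->
  measurable (U : set (caratheodory_type (@lebesgue_outer R d))).
Proof. exact: open_lebesgue_measurable. Qed.

Lemma open_surface_measurable U : open U ->
  measurable (U : set (caratheodory_type (@hausdorff_outer R d d.-1))).
Proof. exact: open_hausdorff_measurable. Qed.

Lemma boundary_measurable Omega :
  measurable (boundary Omega : set (caratheodory_type (@hausdorff_outer R d d.-1))).
Proof.
apply: measurableD; last exact/open_surface_measurable/open_interior.
rewrite -[closure _]setCK; apply: measurableC.
by apply: open_surface_measurable; rewrite openC; exact: closed_closure.
Qed.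

Lemma relatively_open_measurable Omega G : relatively_open (boundary Omega) G ->
  measurable (G : set (caratheodory_type (@hausdorff_outer R d d.-1))).
Proof.
move=> [U oU ->]; apply: measurableI; last exact: boundary_measurable.
exact: open_surface_measurable.
Qed.

Lemma continuous_volume_measurable_fun
    (D : set (caratheodory_type (@lebesgue_outer R d)))
    (f : caratheodory_type (@lebesgue_outer R d) -> R) :
  continuous (f : 'rV[R]_d -> R) -> measurable_fun D f.
Proof.
exact: (@continuous_caratheodory_measurable_fun (@lebesgue_outer R d) _ _
  open_lebesgue_measurable).
Qed.

Lemma continuous_surface_measurable_fun
    (D : set (caratheodory_type (@hausdorff_outer R d d.-1)))
    (f : caratheodory_type (@hausdorff_outer R d d.-1) -> R) :
  continuous (f : 'rV[R]_d -> R) -> measurable_fun D f.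
Proof.
exact: (@continuous_caratheodory_measurable_fun (@hausdorff_outer R d d.-1) _ _
  (open_hausdorff_measurable d.-1)).
Qed.

Definition cube (r : R) : set 'rV[R]_d := box (const_mx (- r)) (const_mx r).

Lemma norm_le_cube (r : R) (x : 'rV[R]_d) : `|x| <= r -> cube r x.
Proof.
move=> xr i; rewrite !mxE -ler_norml; apply: le_trans xr.
rewrite [leRHS]/Num.norm /= mx_normrE; apply/bigmax_geP; right => /=.
by exists (0, i).
Qed.

Lemma volume_cube_lty (r : R) : 0 <= r -> (volume (cube r) < +oo)%E.
Proof.
move=> r0; pose F k := if k == 0%N then cube r else set0.
have cr : (box_gauge (cube r) < +oo)%E.
  have := @box_gauge_le _ _ (cube r) (const_mx (- r)) (const_mx r).
  move=> /(_ _ (@subset_refl _ _))/le_lt_trans; apply; last exact: ltry.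
  by move=> i; rewrite !mxE; lra.
apply: le_lt_trans cr; apply: ereal_inf_lbound; exists F.
  split=> [k|x xr]; first exact: sub_gen_smallest.
  by exists 0%N.
rewrite (@nneseries_split _ _ 0 1)//; last by move=> k _; exact: box_gauge_ge0.
rewrite big_nat1 eseries0 ?adde0//= => k k0 _.
by rewrite /F ifN ?box_gauge0// -lt0n.
Qed.

Lemma bounded_cube D : bounded_set D -> exists r, 0 <= r /\ D `<=` cube r.
Proof.
move=> [M [_ DM]]; exists (`|M| + 1); split; first by rewrite addr_ge0.
move=> x Dx; apply: norm_le_cube; apply: DM => //.
by rewrite (le_lt_trans (ler_norm M))// ltrDl.
Qed.

End measurability.

(** * Translation invariance and the vanishing integral of a derivative *)

Section translation.
Context {R : realType} {d : nat}.
Implicit Types (v : 'rV[R]_d).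

Lemma lebesgue_outer_shift v (X : set 'rV[R]_d) :
  lebesgue_outer ((fun x => x + v) @^-1` X) = lebesgue_outer X.
Proof.
(* One inequality for all shifts suffices: shifting back gives the other. *)
suff H w Y : (lebesgue_outer ((fun x : 'rV[R]_d => (x + w)%R) @^-1` Y) <=
    lebesgue_outer Y)%E.
  apply/eqP; rewrite eq_le H /=.
  have := H (- v) ((fun x => x + v) @^-1` X); congr (lebesgue_outer _ <= _)%E.
  by apply/seteqP; split=> x /=; rewrite subrK.
apply: le_ereal_inf_tmp => _ [F [mF YF] <-].
apply: (@le_trans _ _
  (\sum_(k <oo) box_gauge ((fun x : 'rV[R]_d => (x + w)%R) @^-1` F k))%E).
  apply: ereal_inf_lbound; exists (fun k => (fun x : 'rV[R]_d => x + w) @^-1` F k) => //.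
  split=> [k|x /YF[k _ Fk]]; [exact: sub_gen_smallest|by exists k].
apply: lee_nneseries => [k _ _|k _]; first exact: box_gauge_ge0.
rewrite [leRHS]/box_gauge; case: eqVneq => [->|/set0P[z Fz]].
  by rewrite preimage_set0 box_gauge0.
apply: le_ereal_inf_tmp => _ [[x y] /= Fxy <-].
rewrite (eq_bigr (fun i => (y - w) 0 i - (x - w) 0 i)) => [|i _]; last first.
  by rewrite !mxE; ring.
apply: box_gauge_le.
  by move=> i; rewrite !mxE lerD2r; have /andP[] := Fxy _ Fz i; exact: le_trans.
by move=> p /= /Fxy pxy i; have := pxy i; rewrite !mxE lerBlDr lerBrDr.
Qed.

Let T := caratheodory_type (@lebesgue_outer R d).

(** Caratheodory's criterion for a shifted set, tested on [X], is the criterion for the set itself,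
    tested on [X] shifted back. *)
Lemma shift_measurable v :
  measurable_fun (setT : set T) (fun x : T => (x + v : 'rV[R]_d) : T).
Proof.
move=> _ A mA; rewrite setTI.
have {}mA : (@lebesgue_outer R d).-caratheodory A := mA.
change ((@lebesgue_outer R d).-caratheodory ((fun x : 'rV[R]_d => x + v) @^-1` A)).
move=> X.
have E Y : lebesgue_outer Y = lebesgue_outer ((fun x => x - v) @^-1` Y).
  by rewrite lebesgue_outer_shift.
rewrite /= E mA; congr (_ + _)%E; rewrite [RHS]E; congr lebesgue_outer.
  by apply/seteqP; split=> x /=; rewrite subrK.
by apply/seteqP; split=> x /=; rewrite subrK.
Qed.

Lemma integral_shift v (f : T -> \bar R) : volume.-integrable setT f ->
  (\int[volume]_x f ((x + v)%R : 'rV[R]_d) = \int[volume]_x f x)%E.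
Proof.
move=> intf; have mf : measurable_fun setT f by case/integrableP: intf.
pose s (x : T) : T := (x + v : 'rV[R]_d).
have ms : measurable_fun setT s by exact: shift_measurable.
have E (A : set T) : volume A = pushforward volume s A.
  exact/esym/lebesgue_outer_shift.
have EI (g : T -> \bar R) : (\int[volume]_x g x = \int[pushforward volume s]_x g x)%E.
  by apply: eq_measure_integral => A _ _; rewrite E.
rewrite [RHS]EI integral_pushforward// preimage_setT.
apply/integrableP; split; first exact: measurableT_comp.
have /integrableP[_] := intf; rewrite EI ge0_integral_pushforward//.
exact: measurableT_comp.
Qed.

End translation.

Section line_restriction.
Context {R : realType} {V : normedModType R}.

(** Read one way, it opens directional derivatives to the mean value theorem; read the other way, to
    the one-variable chain rule. *)
Lemma is_derive_line (f : V -> R) (x v : V) (s df : R) :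
  is_derive s 1 (fun t : R => f (t *: v + x)) df <->
  is_derive (s *: v + x) v f df.
Proof.
have E : (fun h : R => h^-1 *: (((fun t : R => f (t *: v + x)) \o shift s) (h *: 1)
     - f (s *: v + x))) =
   (fun h : R => h^-1 *: ((f \o shift (s *: v + x)) (h *: v) - f (s *: v + x))).
  apply/funext => h /=; rewrite /shift /= -[h *: 1]/(h * 1) mulr1.
  by rewrite scalerDl addrA.
by split=> -[]; rewrite /derivable /derive /= ?E -?E => h1 h2;
  split; rewrite /derivable /derive /= ?E -?E.
Qed.

Lemma derive_supported (K : set V) (f : V -> R) (v : V) : closed K ->
  (forall x, ~ K x -> f x = 0) -> forall x, ~ K x -> 'D_v f x = 0.
Proof.
move=> cK f0 x Kx; rewrite (@near_eq_derive _ _ _ f (cst 0)); first exact: derive_cst.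
have : nbhs x (~` K) by apply: open_nbhs_nbhs; split => //; rewrite openC.
by apply: filterS => y /f0.
Qed.

Lemma bounded_supported (K : set V) (f : V -> R) : compact K -> continuous f ->
  (forall x, ~ K x -> f x = 0) -> exists2 M, 0 <= M & forall x, `|f x| <= M.
Proof.
move=> cK cf f0.
have /compact_bounded[M [_ fM]] : compact (f @` K).
  by apply: continuous_compact => //; exact: continuous_subspaceT.
exists (`|M| + 1) => [|x]; first by rewrite addr_ge0.
have [Kx|/f0 ->] := pselect (K x); last by rewrite normr0 addr_ge0.
by apply: fM; [rewrite (le_lt_trans (ler_norm M))// ltrDl|exists x].
Qed.

(** By the mean value theorem; as the bound does not depend on [t], it dominates the difference
    quotients. *)
Lemma difference_quotient_bound (f : V -> R) (v x : V) (M t : R) : 0 < t ->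
  (forall y, derivable f y v) -> (forall y, `|'D_v f y| <= M) ->
  `|t^-1 * (f (t *: v + x) - f x)| <= M.
Proof.
move=> t0 df fM.
have dg (s : R) : is_derive s 1 (fun u : R => f (u *: v + x)) ('D_v f (s *: v + x)).
  by apply/is_derive_line; exact: derivableP.
have [|c _] := @MVT R _ (fun s : R => 'D_v f (s *: v + x)) 0 t t0 (fun s _ => dg s).
  apply: continuous_subspaceT => s.
  apply/differentiable_continuous/derivable1_diffP; by case: (dg s).
rewrite scale0r add0r subr0 => ->.
by rewrite mulrCA mulVf ?gt_eqF// mulr1.
Qed.

End line_restriction.

Section integral_of_derivative.
Context {R : realType} {d : nat}.

Let T := caratheodory_type (@lebesgue_outer R d).

Lemma compact_box (x y : 'rV[R]_d) : compact (box x y).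
Proof.
have := @rV_compact R d (fun i => `[x 0 i, y 0 i]%classic)
  (fun i => @segment_compact _ _ _).
by congr compact; apply/seteqP; split=> p /= xr i; have := xr i; rewrite in_itv.
Qed.

Lemma integral_derive_eq0 (K : set 'rV[R]_d) (h : 'rV[R]_d -> R) (v : 'rV[R]_d) :
  compact K -> (forall x, ~ K x -> h x = 0) ->
  continuous h -> (forall x, derivable h x v) -> continuous ('D_v h) ->
  \int[volume]_x 'D_v h x = 0.
Proof.
move=> cK h0 ch dh cdh.
have clK : closed K by exact: compact_closed.
have dh0 := derive_supported v clK h0.
have [M M0 dhM] := bounded_supported cK cdh dh0.
have [B B0 hB] := bounded_supported cK ch h0.
have [N [N0 KN]] : exists N, 0 <= N /\ forall x, K x -> `|x| <= N.
  have [N [_ KN]] := compact_bounded cK.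
  exists (`|N| + 1); split; first by rewrite addr_ge0.
  by move=> x Kx; apply: KN => //; rewrite (le_lt_trans (ler_norm N))// ltrDl.
(* This cube contains [K] and all its translates by [- t *: v] with [t] at most 1, hence the
   supports of all difference quotients below. *)
pose r := N + `|v|; pose C : set T := cube r.
have r0 : 0 <= r by rewrite addr_ge0.
have mC : measurable C.
  rewrite -[C]setCK; apply: measurableC; apply: open_volume_measurable.
  by rewrite openC; apply: compact_closed => //; exact: compact_box.
have Ch (t : R) x : 0 <= t <= 1 -> ~ C x -> h (t *: v + x) = 0.
  move=> /andP[t0 t1] Cx; apply: h0 => Kx; apply: Cx; apply: norm_le_cube.
  rewrite (_ : x = (t *: v + x) - t *: v); last by rewrite addrC addKr.
  apply: (le_trans (ler_normB _ _)); apply: lerD; first exact: KN.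
  by rewrite normrZ ger0_norm// ler_piMl.
have intC (f : T -> R) (L : R) : measurable_fun setT f ->
    (forall x, `|f x| <= L) -> (forall x, ~ C x -> f x = 0) ->
    volume.-integrable setT (EFin \o f).
  move=> mf fL f0; rewrite (_ : EFin \o f = (EFin \o f) \_ C); last first.
    apply/funext => x; rewrite patchE; case: ifPn => // /negP xC /=.
    by rewrite f0// => Cx; apply: xC; rewrite inE.
  rewrite -integrable_mkcond//; apply: measurable_bounded_integrable => //.
  - exact: volume_cube_lty.
  - exact: measurable_funTS.
  - exists L; split; first exact: num_real.
    by move=> y Ly x Cx; apply: le_trans (ltW Ly).
pose t n : R := n.+1%:R^-1.
have t0 n : 0 < t n by rewrite invr_gt0.
have t1 n : 0 <= t n <= 1 by rewrite ltW//= invf_le1// ler1n.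
pose q n (x : T) : R := (t n)^-1 * (h (t n *: v + x) - h x).
have hC x : ~ C x -> h x = 0.
  by move=> /(Ch 0); rewrite scale0r add0r; apply; rewrite lexx ler01.
have csh n : continuous (fun x => h (t n *: v + x)).
  move=> x; apply: continuous_comp; last exact: ch.
  by apply: (@cvgD _ _ _ (nbhs x)); [exact: cvg_cst|exact: cvg_id].
have mh := continuous_volume_measurable_fun (D := setT) ch.
have msh n := continuous_volume_measurable_fun (D := setT) (csh n).
have ih : volume.-integrable setT (EFin \o (h : T -> R)) by exact: intC mh hB hC.
have ish n : volume.-integrable setT (EFin \o (fun x : T => h (t n *: v + x))).
  by apply: (intC _ B (msh n)) => // x; exact: Ch.
have q0 n : \int[volume]_x q n x = 0.
  rewrite RintegralZl//; last exact: (integrableB _ (ish n) ih).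
  rewrite RintegralB// [X in X - _](_ : _ = \int[volume]_x h x).
    by rewrite subrr mulr0.
  rewrite /Rintegral -(integral_shift (t n *: v) ih).
  by congr fine; apply: eq_integral => x _ /=; rewrite addrC.
have mq n : measurable_fun setT (q n).
  exact: (measurable_funM (measurable_cst _) (measurable_funB (msh n) mh)).
have mdh := continuous_volume_measurable_fun (D := setT) cdh.
have := @dominated_convergence _ T R volume setT measurableT
  (fun n => EFin \o q n) (EFin \o 'D_v h) ((cst M%:E) \_ C).
case.
- by move=> n; apply/measurable_EFinP.
- exact/measurable_EFinP.
- apply: aeW => x _; apply: cvg_EFin => //=; first exact: nearW.
  have tt : t @ \oo --> (0 : R)^'.
    move=> A A0; have H : nbhs (0 : R) (fun y => y != 0 -> A y) := A0.
    have : \forall n \near \oo, t n != 0 -> A (t n) by exact: (@cvg_harmonic R) H.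
    by apply: filterS => n; apply; rewrite gt_eqF.
  by have := cvg_comp _ _ tt (dh x).
- rewrite -integrable_mkcond//; apply: measurable_bounded_integrable => //.
    exact: volume_cube_lty.
  by exists M; split; [exact: num_real|move=> y My z _; rewrite /= ger0_norm// ltW].
- apply: aeW => x n _ /=; rewrite patchE; case: ifPn => [_|/negP xC].
    by rewrite lee_fin; exact: difference_quotient_bound.
  have Cx : ~ C x by move=> Cx; apply: xC; rewrite inE.
  by rewrite /q (hC x)// (Ch _ x)// subrr mulr0 normr0.
move=> _ _ lim.
(* A real integral equal to 0 could come from an infinite one through [fine]; integrability excludes
   this. *)
have lim0 n : (\int[volume]_x (EFin \o q n) x)%E = 0%E.
  have iq := integrableZl measurableT (t n)^-1 (integrableB measurableT (ish n) ih).
  rewrite -[LHS]fineK ?q0//; first exact: congr1 (q0 n).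
  exact: (integrable_fin_num measurableT iq).
have E : (\int[volume]_x ('D_v h x)%:E)%E = 0%E.
  apply: (cvg_unique _ lim) => //.
  by rewrite (funext lim0); exact: cvg_cst.
by rewrite /Rintegral E.
Qed.

End integral_of_derivative.

(** * Smooth functions, bumps and cutoffs *)

Section smooth_functions.
Context {R : realType} {d : nat}.
Implicit Types (f g : 'rV[R]_d -> R) (k : nat).

Lemma class_C_continuous k f : class_C k f -> continuous f.
Proof. by case: k => [|k] []. Qed.

Lemma class_CS k f : class_C k.+1 f -> class_C k f.
Proof.
elim: k f => [|k IH] f [cf df]; first by split.
by split => // i; have [? ?] := df i; split => //; exact: IH.
Qed.

Lemma class_CD k f g : class_C k f -> class_C k g -> class_C k (f \+ g).
Proof.
elim: k f g => [|k IH] f g [cf df] [cg dg];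
  (split; first by move=> x;
    apply: (@continuousD _ _ _ f g x); [exact: cf|exact: cg]) => //.
move=> i; have [dfi Cf] := df i; have [dgi Cg] := dg i.
split=> [x|]; first exact: derivableD.
rewrite (_ : 'D_(ebasis i) _ = 'D_(ebasis i) f \+ 'D_(ebasis i) g); first exact: IH.
by apply/funext => x; rewrite deriveD.
Qed.

Lemma class_CM k f g : class_C k f -> class_C k g -> class_C k (f \* g).
Proof.
elim: k f g => [|k IH] f g Hf Hg; have [cf df] := Hf; have [cg dg] := Hg;
  (split; first by move=> x; apply: (@continuousM _ _ f g x); [exact: cf|exact: cg]) => //.
move=> i; have [dfi Cf] := df i; have [dgi Cg] := dg i.
split=> [x|]; first exact: derivableM.
rewrite (_ : 'D_(ebasis i) _ =
    (f \* 'D_(ebasis i) g) \+ (g \* 'D_(ebasis i) f)).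
  by apply: class_CD; apply: IH => //; exact: class_CS.
by apply/funext => x; rewrite deriveM.
Qed.

Lemma smooth_cst (c : R) : @smooth R d (fun=> c).
Proof.
move=> k; elim: k c => [|k IH] c; split => //; try exact: cst_continuous.
move=> i; split=> [x|]; first exact: derivable_cst.
rewrite (_ : 'D_(ebasis i) _ = cst 0); first exact: IH.
by apply/funext => x; rewrite derive_cst.
Qed.

Lemma smoothD f g : smooth f -> smooth g -> smooth (fun x => f x + g x).
Proof. by move=> sf sg k; exact: class_CD. Qed.

Lemma smoothM f g : smooth f -> smooth g -> smooth (fun x => f x * g x).
Proof. by move=> sf sg k; exact: class_CM. Qed.

Lemma smooth_prod (I : Type) (r : seq I) (f : I -> 'rV[R]_d -> R) :
  (forall i, smooth (f i)) -> smooth (fun x => \prod_(i <- r) f i x).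
Proof.
move=> sf; elim: r => [|i r IH].
  by under eq_fun do rewrite big_nil; exact: smooth_cst.
by under eq_fun do rewrite big_cons; exact: smoothM.
Qed.

Lemma smooth_continuous f : smooth f -> continuous f.
Proof. by move=> /(_ 0%N); exact: class_C_continuous. Qed.

Lemma smooth_derivable f (i : 'I_d) x : smooth f -> derivable f x (ebasis i).
Proof. by move=> /(_ 1%N)[_ /(_ i)[]]. Qed.

Lemma smooth_derive f (i : 'I_d) : smooth f -> smooth ('D_(ebasis i) f).
Proof. by move=> sf k; have [_ /(_ i)[]] := sf k.+1. Qed.

End smooth_functions.

Section flat_function.
Context {R : realType}.

(* The whole family is carried along because it is stable under
   differentiation up to linear combinations, see [is_derive_flat]. *)
Definition flat (n : nat) (t : R) : R :=
  if 0 < t then t^-1 ^+ n * expR (- t^-1) else 0.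

Lemma flat_ge0 n t : 0 <= flat n t.
Proof.
rewrite /flat; case: ifPn => // t0.
by rewrite mulr_ge0 ?exprn_ge0 ?expR_ge0// invr_ge0 ltW.
Qed.

Lemma flat0_le1 t : flat 0 t <= 1.
Proof.
rewrite /flat; case: ifPn => // t0.
by rewrite expr0 mul1r expR_le1 oppr_le0 invr_ge0 ltW.
Qed.

(** The term of degree [n.+2] of the exponential series at [t^-1] bounds [expR t^-1] from below. Two
    degrees more than [n] leave the factor [t ^+ 2], so that difference quotients at 0 tend to 0. *)
Lemma flat_le (n : nat) (t : R) : `|flat n t| <= n.+2`!%:R * t ^+ 2.
Proof.
rewrite ger0_norm ?flat_ge0// /flat; case: ifPn => [t0|_]; last first.
  by rewrite mulr_ge0// sqr_ge0.
have y0 : 0 < t^-1 by rewrite invr_gt0.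
have H : t^-1 ^+ n.+2 / n.+2`!%:R <= expR t^-1.
  by have := expR_ge1Dxn n.+1 (ltW y0); apply: le_trans; rewrite lerDr.
rewrite expRN ler_pdivrMr ?expR_gt0//.
have t2 : 0 < t ^+ 2 by rewrite exprn_gt0.
have F0 : 0 < n.+2`!%:R :> R by rewrite ltr0n fact_gt0.
apply: le_trans (ler_wpM2l (mulr_ge0 (ltW F0) (ltW t2)) H).
rewrite le_eqVlt; apply/orP; left; apply/eqP.
by rewrite !exprS; field; rewrite !gt_eqF.
Qed.

Lemma is_derive_flat (n : nat) (t : R) :
  is_derive t 1 (flat n) (flat n.+2 t - n%:R * flat n.+1 t).
Proof.
have [t0|t0|->] := ltgtP t 0.
- rewrite /flat ltNge ltW//= mulr0 subr0.
  apply: (@near_eq_is_derive _ _ _ (cst 0)).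
  by near=> s; rewrite ltNge ltW//; near: s; exact: lt_nbhsl.
- rewrite /flat t0.
  pose G (y : R) := y ^+ n * expR (- y).
  apply: (@near_eq_is_derive _ _ _ (G \o (fun s : R => s^-1))).
    by near=> s; rewrite ifT//; near: s; exact: lt_nbhsr.
  have dI : is_derive t 1 (fun s : R => s^-1) (- t ^- 2 *: 1).
    by apply: is_deriveV; rewrite ?gt_eqF.
  have dE : is_derive t^-1 1 (fun y : R => expR (- y)) (expR (- t^-1) * (- 1)).
    exact: (is_derive1_comp (f := expR) (g := fun y => - y)).
  have dX : is_derive t^-1 1 (fun y : R => y ^+ n) ((n%:R * t^-1 ^+ n.-1) *: 1).
    rewrite (_ : (fun y : R => y ^+ n) = id ^+ n); last first.
      by apply/funext => y; rewrite exprfctE.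
    exact: is_deriveX.
  have dG := is_deriveM dX dE.
  have dGI := is_derive1_comp (f := G) (g := fun s : R => s^-1) dG dI.
  apply: (@is_derive_eq _ _ _ _ _ _ _ _ dGI); rewrite -![_ *: _]/(_ * _).
  rewrite -exprVn expr2; set y := t^-1; set E := expR (- y).
  rewrite [_ * (y ^+ n.+1 * E)]mulrA.
  (* For [n = 0] the truncated exponent is harmless, because the factor [n%:R] vanishes. *)
  have : n%:R * y ^+ n.+1 = n%:R * y ^+ n.-1 * y ^+ 2.
    by case: (n) => [|j]; rewrite ?mul0r// -mulrA -exprD addn2.
  by move=> ->; rewrite !exprS; ring.
rewrite [X in is_derive _ _ _ X](_ : _ = 0); last first.
  by rewrite /flat ltxx mulr0 subrr.
suff H : (fun h : R => h^-1 *: ((flat n \o shift 0) (h *: 1) - flat n 0)) @ 0^' --> (0 : R).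
  by split; [apply/cvg_ex; exists 0|exact/cvg_lim].
apply/cvgrPdist_le => e e0; near=> h.
rewrite sub0r normrN /= addr0 -[h *: 1]/(h * 1) mulr1 -[_ *: _]/(_ * _).
rewrite [flat n 0]/flat ltxx subr0 normrM.
have F0 : 0 < n.+2`!%:R :> R by rewrite ltr0n fact_gt0.
have h0 : h != 0 by near: h; exact: nbhs_dnbhs_neq.
apply: (@le_trans _ _ (`|h^-1| * (n.+2`!%:R * h ^+ 2))).
  by rewrite ler_wpM2l// flat_le.
have -> : `|h^-1| * (n.+2`!%:R * h ^+ 2) = n.+2`!%:R * `|h|.
  by rewrite -[h ^+ 2]real_normK ?num_real// normfV; field; rewrite normr_eq0.
rewrite mulrC -ler_pdivlMr//.
by near: h; apply: dnbhs0_le; rewrite divr_gt0.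
Unshelve. all: by end_near. Qed.

End flat_function.

Section bump_functions.
Context {R : realType} {d : nat}.
Implicit Types (x y p : 'rV[R]_d) (f g : 'rV[R]_d -> R).

Lemma is_derive_flat_coord (i j : 'I_d) (n : nat) (s c : R) p :
  is_derive p (ebasis i) (fun x => flat n (s * x 0 j + c))
    (s * (i == j)%:R *
     (flat n.+2 (s * p 0 j + c) - n%:R * flat n.+1 (s * p 0 j + c))).
Proof.
have <- : 0 *: ebasis i + p = p :> 'rV[R]_d by rewrite scale0r add0r.
apply/is_derive_line.
rewrite scale0r add0r.
pose a : R := s * (i == j)%:R; pose y := s * p 0 j + c.
have -> : (fun t : R => flat n (s * (t *: ebasis i + p) 0 j + c)) =
    flat n \o (fun t : R => a * t + y).
  apply/funext => t /=; congr flat; rewrite !mxE eqxx /= eq_sym /a /y; ring.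
have dA : is_derive (0 : R) 1 (fun t : R => a * t + y) a.
  have dA := is_deriveD (is_deriveZ a (is_derive_id (0 : R) (1 : R)))
    (is_derive_cst (y : R) (0 : R) (1 : R)).
  apply: (@is_derive_eq _ _ _ _ _ _ _ _ dA).
  by rewrite addr0 -[_ *: _]/(_ * _) mulr1.
have := is_derive_flat n ((fun t : R => a * t + y) 0).
rewrite /= mulr0 add0r => dF.
rewrite mulrC; apply: is_derive1_comp => //=.
by rewrite mulr0 add0r.
Qed.

(** The induction on the class is for all [n] at once, as differentiation raises [n]. The slopes
    [s = 1] and [s = -1] serve the two opposite faces of a box. *)
Lemma smooth_flat_coord (j : 'I_d) (n : nat) (s c : R) :
  smooth (fun x : 'rV[R]_d => flat n (s * x 0 j + c)).
Proof.
move=> k; elim: k n => [|k IH] n.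
  split=> // p.
  apply: (@continuous_comp _ _ _ (fun x : 'rV[R]_d => s * x 0 j + c) (flat n));
    last first.
    apply/differentiable_continuous/derivable1_diffP.
    by case: (is_derive_flat n (s * p 0 j + c)).
  have : (fun x : 'rV[R]_d => s * x 0 j + c) @ p --> s * p 0 j + c.
    apply: (@cvgD _ _ _ (nbhs p)); last exact: cvg_cst.
    by apply: (@cvgM _ _ (nbhs p)); [exact: cvg_cst|exact: coord_continuous].
  by [].
split; first exact: (class_C_continuous (IH n)).
move=> i; split=> [x|]; first by case: (is_derive_flat_coord i j n s c x).
rewrite (_ : 'D_(ebasis i) _ = (fun=> s * (i == j)%:R) \*
   ((fun x => flat n.+2 (s * x 0 j + c)) \+
    ((fun=> - n%:R) \* (fun x => flat n.+1 (s * x 0 j + c))))).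
  apply: class_CM; first exact: smooth_cst.
  by apply: class_CD => //; apply: class_CM => //; exact: smooth_cst.
apply/funext => x; have [_ ->] := is_derive_flat_coord i j n s c x.
by rewrite /= mulNr.
Qed.

Definition bump x y p : R :=
  \prod_(j < d) (flat 0 (p 0 j - x 0 j) * flat 0 (y 0 j - p 0 j)).

Lemma smooth_bump x y : smooth (bump x y).
Proof.
apply: smooth_prod => j; apply: smoothM.
- have := smooth_flat_coord j 0 1 (- x 0 j).
  by congr smooth; apply/funext => p; rewrite mul1r.
- have := smooth_flat_coord j 0 (-1) (y 0 j).
  by congr smooth; apply/funext => p; rewrite mulN1r addrC.
Qed.

Lemma bump_ge0 x y p : 0 <= bump x y p.
Proof. by apply: prodr_ge0 => j _; rewrite mulr_ge0// flat_ge0. Qed.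

Lemma bump_le1 x y p : bump x y p <= 1.
Proof.
apply: prodr_ile1 => j _.
by rewrite mulr_ge0 ?flat_ge0//= mulr_ile1 ?flat_ge0 ?flat0_le1.
Qed.

Lemma bump_gt0 x y p : open_box x y p -> 0 < bump x y p.
Proof.
move=> xyp; apply: prodr_gt0 => j _; have /andP[h1 h2] := xyp j.
by rewrite /flat !subr_gt0 h1 h2 !expr0 !mul1r mulr_gt0// expR_gt0.
Qed.

Lemma bump_eq0 x y p : ~ box x y p -> bump x y p = 0.
Proof.
move=> /existsNP[j /negP]; rewrite negb_and -!ltNge => H.
rewrite /bump (bigD1 j)//= /flat !subr_gt0.
by case/orP: H => /ltW; rewrite leNgt => /negbTE ->; rewrite ?mul0r ?mulr0 ?mul0r.
Qed.

End bump_functions.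

Section cutoff.
Context {R : realType} {d : nat}.
Variable Omega : set 'rV[R]_d.
Implicit Types (f g : 'rV[R]_d -> R).

Lemma test_functionM f g : smooth f -> test_function Omega g ->
  test_function Omega (fun x => f x * g x).
Proof.
move=> sf [sg [K [cK KO g0]]]; split; first exact: smoothM.
by exists K; split => // x /g0 ->; rewrite mulr0.
Qed.

(** These functions equal 1 off a compact subset of [Omega] and are stable under products. So one
    minus a product of factors [1 - rho n] is a test function without being expanded. *)
Definition cotest f : Prop := test_function Omega (fun x => 1 - f x).

Lemma cotest_smooth f : cotest f -> smooth f.
Proof.
move=> [sf _]; have := smoothD (smooth_cst 1) (smoothM (smooth_cst (-1)) sf).
by congr smooth; apply/funext => x; rewrite mulN1r opprB subrKC.
Qed.

Lemma cotest1 : cotest (fun=> 1).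
Proof.
split; first by rewrite subrr; exact: smooth_cst.
by exists set0; split => //; [exact: compact0|move=> x _; rewrite subrr].
Qed.

Lemma cotestM f g : cotest f -> cotest g -> cotest (fun x => f x * g x).
Proof.
move=> cf cg; have sf := cotest_smooth cf; have sg := cotest_smooth cg.
move: cf cg => [_ [K [cK KO f1]]] [_ [L [cL LO g1]]]; split.
  have := smoothD (smooth_cst 1) (smoothM (smooth_cst (-1)) (smoothM sf sg)).
  by congr smooth; apply/funext => x; rewrite mulN1r.
exists (K `|` L); split; first exact: compactU.
  by move=> x [/KO|/LO].
move=> x /not_orP[/f1/eqP + /g1/eqP]; rewrite !subr_eq0 => /eqP <- /eqP <-.
by rewrite mulr1 subrr.
Qed.

Lemma cotest_prod (I : Type) (r : seq I) (f : I -> 'rV[R]_d -> R) :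
  (forall i, cotest (f i)) -> cotest (fun x => \prod_(i <- r) f i x).
Proof.
move=> cf; elim: r => [|i r IH].
  by under eq_fun do rewrite big_nil; exact: cotest1.
by under eq_fun do rewrite big_cons; exact: cotestM.
Qed.

(** Countably many bumps suffice: every point of [Omega] lies inside a rational box contained in
    [Omega], where the bump of that box is positive. *)
Lemma cutoff_sequence : open Omega -> exists eta : nat -> 'rV[R]_d -> R,
  [/\ forall k, test_function Omega (eta k),
      forall k x, 0 <= eta k x <= 1 &
      forall x, Omega x -> eta k x @[k --> \oo] --> (1 : R)].
Proof.
move=> oO.
(* Numbers that code no pair of corners, or a box leaving [Omega], get the zero function. *)
pose rho n : 'rV[R]_d -> R :=
  if @unpickle ('rV[rat]_d * 'rV[rat]_d)%type n is Some q then
    if `[< box (rat_point q.1 : 'rV[R]_d) (rat_point q.2) `<=` Omega >]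
    then bump (rat_point q.1) (rat_point q.2) else fun=> 0
  else fun=> 0.
have rho01 n x : 0 <= rho n x <= 1.
  rewrite /rho; case: unpickle => [q|]; last by rewrite lexx ler01.
  by case: ifPn => _; rewrite ?bump_ge0 ?bump_le1 ?lexx ?ler01.
have crho n : cotest (fun x => 1 - rho n x).
  rewrite /cotest; under eq_fun do rewrite opprB subrKC.
  have T0 : test_function Omega (fun=> 0).
    by split; [exact: smooth_cst|exists set0; split => //; exact: compact0].
  rewrite /rho; case: unpickle => [q|] //.
  case: ifPn => // /asboolP qO; split; first exact: smooth_bump.
  exists (box (rat_point q.1) (rat_point q.2)).
  by split => //; [exact: compact_box|exact: bump_eq0].
(* The factor of a box around [x] occurs with the growing exponent [k], so
   that the double product tends to [0] at [x]. *)
pose eta k (x : 'rV[R]_d) := 1 - \prod_(n < k) \prod_(m < k) (1 - rho n x).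
have P01 k x : 0 <= \prod_(n < k) \prod_(m < k) (1 - rho n x) <= 1.
  apply/andP; split.
    apply: prodr_ge0 => i _; apply: prodr_ge0 => j _.
    by rewrite subr_ge0; case/andP: (rho01 i x).
  apply: prodr_ile1 => i _; apply/andP; split.
    by apply: prodr_ge0 => ? _; rewrite subr_ge0; case/andP: (rho01 i x).
  by apply: prodr_ile1 => ? _; have := rho01 i x; lra.
exists eta; split.
- by move=> k; apply: cotest_prod => n; apply: cotest_prod => m; exact: crho.
- by move=> k x; have /andP[h1 h2] := P01 k x; rewrite /eta; apply/andP; split; lra.
move=> x Ox; have [q [xq qO]] := open_rat_box oO Ox.
pose n := pickle q.
have rn : 0 < rho n x by rewrite /rho /n pickleK asboolT// bump_gt0.
rewrite -[X in _ --> X]subr0; apply: cvgB; first exact: cvg_cst.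
apply: (@squeeze_cvgr _ _ _ _ (fun=> 0) (fun k => (1 - rho n x) ^+ k)).
- near=> k; have /andP[-> _] := P01 k x; rewrite /=.
  have nk : (n < k)%N by near: k; exact: nbhs_infty_gt.
  rewrite (bigD1 (Ordinal nk))//= prodr_const card_ord.
  rewrite ler_piMr ?exprn_ge0 ?subr_ge0//; first by case/andP: (rho01 n x).
  apply: prodr_ile1 => i _; apply/andP; split.
    by apply: prodr_ge0 => ? _; rewrite subr_ge0; case/andP: (rho01 i x).
  by apply: prodr_ile1 => ? _; have := rho01 i x; lra.
- exact: cvg_cst.
- have /andP[h1 h2] := rho01 n x.
  apply: cvg_expr; rewrite ger0_norm; lra.
Unshelve. all: by end_near. Qed.

End cutoff.

(** * Test functions as Sobolev functions, and passage from test functions to [H1] *)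

Section sobolev_space.
Context {R : realType} {d : nat}.
Variable Omega : set 'rV[R]_d.
Hypotheses (oO : open Omega) (bO : bounded_set Omega).
Implicit Types (f g phi : 'rV[R]_d -> R) (u v w : sobolev R d).

Let mO : measurable (Omega : set (caratheodory_type (@lebesgue_outer R d))).
Proof. exact: open_volume_measurable. Qed.

Let mB := boundary_measurable Omega.

Lemma volume_bounded_lty : (volume Omega < +oo)%E.
Proof.
have [r [r0 Or]] := bounded_cube bO.
by apply: le_lt_trans (volume_cube_lty r0); exact: le_mu_ext.
Qed.

Lemma continuous_supported_L2 (K : set 'rV[R]_d) f : compact K ->
  continuous f -> (forall x, ~ K x -> f x = 0) -> L2 volume Omega f.
Proof.
move=> cK cf f0; have [M M0 fM] := bounded_supported cK cf f0.
apply: (@le_sqr_L2 _ _ _ _ _ mO _ (fun=> M ^+ 2)).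
- exact: continuous_volume_measurable_fun.
- apply: measurable_bounded_integrable => //; first exact: volume_bounded_lty.
  exists (M ^+ 2); split; first exact: num_real.
  by move=> y My z _; rewrite /= ger0_norm ?sqr_ge0// ltW.
- move=> x _; rewrite -real_normK ?num_real//.
  by rewrite lerXn2r ?nnegrE.
Qed.

Lemma test_function_L2 phi : test_function Omega phi -> L2 volume Omega phi.
Proof.
move=> [sphi [K [cK KO phi0]]]; apply: (continuous_supported_L2 cK) => //.
exact: smooth_continuous.
Qed.

Lemma test_function_derive_L2 phi (i : 'I_d) : test_function Omega phi ->
  L2 volume Omega ('D_(ebasis i) phi).
Proof.
move=> [sphi [K [cK KO phi0]]]; apply: (continuous_supported_L2 cK).
  exact/smooth_continuous/smooth_derive.
by apply: derive_supported => //; exact: compact_closed.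
Qed.

Lemma test_function_weak_partial phi (i : 'I_d) : test_function Omega phi ->
  weak_partial Omega i phi ('D_(ebasis i) phi).
Proof.
move=> tphi psi tpsi.
have tM : test_function Omega (fun x => phi x * psi x).
  by apply: test_functionM => //; case: tphi.
have [sphi _] := tphi; have [spsi _] := tpsi.
have [sM [K [cK KO M0]]] := tM.
have clK : closed K by exact: compact_closed.
have D0 := derive_supported (ebasis i) clK M0.
have := integral_derive_eq0 cK M0 (smooth_continuous sM)
  (fun x => @smooth_derivable _ _ _ i x sM) (smooth_continuous (@smooth_derive _ _ _ i sM)).
(* The product is supported in a compact subset of [Omega], so its vanishing integral over the whole
   space is an integral over [Omega], to which the product rule applies. *)
rewrite (_ : 'D_(ebasis i) _ = 'D_(ebasis i) (fun x => phi x * psi x) \_ Omega); last first.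
  apply/funext => x; rewrite patchE; case: ifPn => // /negP xO.
  by apply: D0 => /KO Ox; apply: xO; rewrite inE.
rewrite -Rintegral_mkcond.
have -> : \int[volume]_(x in Omega) 'D_(ebasis i) (fun x => phi x * psi x) x =
    \int[volume]_(x in Omega) (phi x * 'D_(ebasis i) psi x + 'D_(ebasis i) phi x * psi x).
  apply: eq_Rintegral.
  move=> x _; rewrite deriveM; [|exact: smooth_derivable..].
  by rewrite -[_ *: _]/(_ * _) -[X in _ + X]/(_ * _) [X in _ + X]mulrC.
rewrite RintegralD//.
- by move/eqP; rewrite addr_eq0 => /eqP.
- exact (L2_integrableM mO (test_function_L2 tphi) (test_function_derive_L2 i tpsi)).
- exact (L2_integrableM mO (test_function_derive_L2 i tphi) (test_function_L2 tpsi)).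
Qed.

Definition test_sobolev phi : sobolev R d := (phi, gradient phi, fun=> 0).

Lemma test_sobolev_H1D GD phi : test_function Omega phi ->
  H1D Omega GD (test_sobolev phi).
Proof.
move=> tphi; have [sphi [K [cK KO phi0]]] := tphi.
have gE i : (fun x => gradient phi x 0 i) = 'D_(ebasis i) phi.
  by apply/funext => x; rewrite mxE.
split; last by apply: aeW.
split.
- exact: test_function_L2.
- by move=> i; rewrite /grad /= gE; exact: test_function_derive_L2.
- by move=> i; rewrite /grad /= gE; exact: test_function_weak_partial.
split; first exact: L2_cst0.
exists (fun=> phi); split => //; first exact: cvg_L2_eq.
  by move=> i; rewrite /grad /= gE; exact: cvg_L2_eq.
(* An open [Omega] is its own interior, hence disjoint from its boundary, so [phi] vanishes
   there. *)
apply: cvg_L2_eq => _ x [_ Ox] /=; apply: phi0 => /KO.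
by move/interior_id : oO => <-.
Qed.

Lemma H1B u v : H1 Omega u -> H1 Omega v -> H1 Omega (u - v).
Proof.
move=> [Lu Gu Wu [Tu [p [sp p1 p2 p3]]]] [Lv Gv Wv [Tv [q [sq q1 q2 q3]]]].
have gE i : (fun x => grad (u - v) x 0 i) = (fun x => grad u x 0 i - grad v x 0 i).
  by apply/funext => x; rewrite !mxE.
split.
- exact: L2B mO _ _ Lu Lv.
- by move=> i; rewrite gE; apply: L2B.
- move=> i phi tphi; rewrite gE.
  have L1 := test_function_derive_L2 i tphi.
  have L2' := test_function_L2 tphi.
  rewrite [LHS](pairingBl mO Lu Lv L1) (pairingBl mO (Gu i) (Gv i) L2').
  by rewrite Wu// Wv// opprB opprK addrC.
split; first exact: L2B mB _ _ Tu Tv.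
have sub (f g : 'rV[R]_d -> R) : smooth f -> smooth g -> smooth (fun x => f x - g x).
  move=> sf sg; have := smoothD sf (smoothM (smooth_cst (-1)) sg).
  by congr smooth; apply/funext => x; rewrite mulN1r.
exists (fun k x => p k x - q k x); split.
- by move=> k; exact: sub.
- have mp k := continuous_volume_measurable_fun (D := Omega) (smooth_continuous (sp k)).
  have mq k := continuous_volume_measurable_fun (D := Omega) (smooth_continuous (sq k)).
  exact: (cvg_L2B mO mp mq (proj1 Lu) (proj1 Lv) p1 q1).
- move=> i; rewrite gE.
  have mp k := continuous_volume_measurable_fun (D := Omega)
    (smooth_continuous (@smooth_derive _ _ _ i (sp k))).
  have mq k := continuous_volume_measurable_fun (D := Omega)
    (smooth_continuous (@smooth_derive _ _ _ i (sq k))).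
  rewrite (_ : (fun k => _) = (fun k x => 'D_(ebasis i) (p k) x - 'D_(ebasis i) (q k) x)).
    exact: (cvg_L2B mO mp mq (proj1 (Gu i)) (proj1 (Gv i)) (p2 i) (q2 i)).
  apply/funext => k; apply/funext => x.
  by rewrite deriveB//; exact: smooth_derivable.
- have mp k := continuous_surface_measurable_fun (D := boundary Omega)
    (smooth_continuous (sp k)).
  have mq k := continuous_surface_measurable_fun (D := boundary Omega)
    (smooth_continuous (sq k)).
  exact: (cvg_L2B mB mp mq (proj1 Tu) (proj1 Tv) p3 q3).
Qed.

Lemma H1_with_traceB GD phi u v :
  H1_with_trace Omega GD phi u -> H1_with_trace Omega GD phi v ->
  H1D Omega GD (u - v).
Proof.
move=> [Hu tu] [Hv tv]; split; first exact: H1B.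
apply: (@filterS2 _ _ (ae_filter_ringOfSetsType surface) _ _ _ _ tu tv) => x {}tu {}tv GDx.
by rewrite [trace _ x](_ : _ = trace u x - trace v x)// tu// tv// subrr.
Qed.

(** There is no condition on the trace of [w]: by dominated convergence the cutoffs disappear in the
    integral against [g], whatever the values near the boundary. *)
Lemma pairing_test_eq0 g w : L2 volume Omega g -> H1 Omega w ->
  (forall phi, test_function Omega phi -> pairing volume Omega g phi = 0) ->
  pairing volume Omega g (fval w) = 0.
Proof.
move=> Lg [Lw _ _ [_ [p [sp pw _ _]]]] g0.
have mp k : measurable_fun (Omega : set (caratheodory_type (@lebesgue_outer R d))) (p k).
  by apply: continuous_volume_measurable_fun; exact: smooth_continuous.
apply: (pairing_cvg_L2_eq0 mO mp Lw Lg pw) => k Lp.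
have [eta [teta eta01 eta1]] := cutoff_sequence oO.
have := @dominated_convergence _ _ R volume Omega mO
  (fun n => EFin \o (fun x => g x * (p k x * eta n x))) (EFin \o (fun x => g x * p k x))
  (EFin \o (fun x => `|g x * p k x|)).
have mg := proj1 Lg.
have igp := L2_integrableM mO Lg Lp.
case.
- move=> n; apply/measurable_EFinP; apply: (measurable_funM mg).
  apply: (measurable_funM (mp k)).
  by apply: continuous_volume_measurable_fun; apply: smooth_continuous; case: (teta n).
- exact/measurable_EFinP/(measurable_funM mg (mp k)).
- apply: aeW => x Ox; apply: cvg_EFin; first exact: nearW.
  have : (g x * p k x) * eta n x @[n --> \oo] --> (g x * p k x) * 1.
    by apply: cvgM; [exact: cvg_cst|exact: eta1].
  rewrite mulr1; apply: cvg_trans; apply: near_eq_cvg.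
  by apply: nearW => n; rewrite /= mulrA.
- exact: integrable_norm.
- apply: aeW => x n Ox; rewrite /= lee_fin mulrA normrM ler_piMr//.
  by have /andP[h1 h2] := eta01 n x; rewrite ger0_norm.
move=> _ _ lim.
have lim0 n : (\int[volume]_(x in Omega)
    (EFin \o (fun x => g x * (p k x * eta n x))%R) x)%E = 0%E.
  have tpe : test_function Omega (fun x => p k x * eta n x).
    exact: test_functionM.
  have iq := L2_integrableM mO Lg (test_function_L2 tpe).
  rewrite -[LHS](fineK (integrable_fin_num mO iq)).
  exact: congr1 (g0 _ tpe).
rewrite /pairing /Rintegral.
have -> : (\int[volume]_(x in Omega) (g x * p k x)%:E)%E = 0%E; last by [].
apply: (cvg_unique _ lim) => //.
by rewrite (funext lim0); exact: cvg_cst.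
Qed.

End sobolev_space.

(** * Linearity of the forms and the normal flux *)

Section forms.
Context {R : realType} {d : nat}.
Variable Omega : set 'rV[R]_d.
Hypothesis oO : open Omega.
Implicit Types (F G : 'rV[R]_d -> 'rV[R]_d) (t s u v : sobolev R d).

Let mO : measurable (Omega : set (caratheodory_type (@lebesgue_outer R d))).
Proof. exact: open_volume_measurable. Qed.

Lemma L2vB F G : L2v Omega F -> L2v Omega G -> L2v Omega (fun x => F x - G x).
Proof.
move=> LF LG i; under eq_fun do rewrite !mxE.
exact: L2B mO _ _ (LF i) (LG i).
Qed.

Lemma L2v_dot (b : 'rV[R]_d -> 'rV[R]_d) F : Linftyv Omega b -> L2v Omega F ->
  L2 volume Omega (fun x => dot (b x) (F x)).
Proof.
move=> Lb LF; apply: (L2_sum mO) => i.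
exact: (LinftyM_L2 mO (Lb i) (LF i)).
Qed.

Lemma L2v_matvec (A : 'rV[R]_d -> 'M[R]_d) F : Linftym Omega A -> L2v Omega F ->
  L2v Omega (fun x => matvec (A x) (F x)).
Proof.
move=> LA LF i.
rewrite (_ : (fun x => _) = (fun x => \sum_j A x i j * F x 0 j)).
  by apply: (L2_sum mO) => j; exact: (LinftyM_L2 mO (LA i j) (LF j)).
by apply/funext => x; rewrite !mxE; apply: eq_bigr => j _; rewrite mxE.
Qed.

Lemma vpairingE F G : L2v Omega F -> L2v Omega G ->
  vpairing Omega F G =
  \sum_i pairing volume Omega (fun x => F x 0 i) (fun x => G x 0 i).
Proof.
move=> LF LG; rewrite /vpairing /pairing /dot.
elim: (index_enum _) => [|i r IH].
  by rewrite big_nil; under eq_Rintegral do rewrite big_nil; rewrite Rintegral_cst// mul0r.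
rewrite big_cons -IH.
under eq_Rintegral do rewrite big_cons.
rewrite RintegralD//.
- exact (L2_integrableM mO (LF i) (LG i)).
rewrite (_ : EFin \o _ =
    (fun x => \sum_(j <- r) ((F x 0 j * G x 0 j)%:E))%E); last first.
  by apply/funext => x; rewrite /= sumEFin.
by apply: integrable_sum => // j _; exact (L2_integrableM mO (LF j) (LG j)).
Qed.

Lemma vpairingBl F G H : L2v Omega F -> L2v Omega G -> L2v Omega H ->
  vpairing Omega (fun x => F x - G x) H = vpairing Omega F H - vpairing Omega G H.
Proof.
move=> LF LG LH; rewrite (vpairingE (L2vB LF LG) LH) (vpairingE LF LH) (vpairingE LG LH).
rewrite -sumrB; apply: eq_bigr => i _.
rewrite -(pairingBl mO (LF i) (LG i) (LH i)); congr pairing.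
by apply/funext => x; rewrite !mxE.
Qed.

Lemma vpairingBr F G H : L2v Omega F -> L2v Omega G -> L2v Omega H ->
  vpairing Omega H (fun x => F x - G x) = vpairing Omega H F - vpairing Omega H G.
Proof.
move=> LF LG LH; rewrite (vpairingE LH (L2vB LF LG)) (vpairingE LH LF) (vpairingE LH LG).
rewrite -sumrB; apply: eq_bigr => i _.
rewrite -(pairingBr mO (LF i) (LG i) (LH i)); congr pairing.
by apply/funext => x; rewrite !mxE.
Qed.

Variables (A : 'rV[R]_d -> 'M[R]_d) (b : 'rV[R]_d -> 'rV[R]_d) (c : 'rV[R]_d -> R).
Hypotheses (LA : Linftym Omega A) (Lb : Linftyv Omega b)
  (Lc : Linfty volume Omega c).

Lemma lower_order_L2 t : H1 Omega t ->
  L2 volume Omega (fun x => dot (b x) (grad t x) + c x * fval t x).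
Proof.
move=> [Lt Gt _ _]; apply: (L2D mO (L2v_dot Lb Gt)).
exact: (LinftyM_L2 mO Lc Lt).
Qed.

Lemma bformBr t u v : H1 Omega t -> H1 Omega u -> H1 Omega v ->
  bform Omega A b c t (u - v) = bform Omega A b c t u - bform Omega A b c t v.
Proof.
move=> Ht [Lu Gu _ _] [Lv Gv _ _]; have Lt := lower_order_L2 Ht.
have [_ Gt _ _] := Ht; rewrite /bform.
have E := f_equal2 +%R (vpairingBr Gu Gv (L2v_matvec LA Gt)) (pairingBr mO Lu Lv Lt).
by etransitivity; [exact E|rewrite addrACA opprD].
Qed.

Lemma bformBl s u v : H1 Omega s -> H1 Omega u -> H1 Omega v ->
  bform Omega A b c (u - v) s = bform Omega A b c u s - bform Omega A b c v s.
Proof.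
move=> [Ls Gs _ _] Hu Hv; have Lu := lower_order_L2 Hu; have Lv := lower_order_L2 Hv.
have [_ Gu _ _] := Hu; have [_ Gv _ _] := Hv; rewrite /bform.
have E := f_equal2 +%R (vpairingBl (L2v_matvec LA Gu) (L2v_matvec LA Gv) Gs)
  (pairingBl mO Lu Lv Ls).
rewrite opprD addrACA; etransitivity; [|exact E].
apply: f_equal2; [congr vpairing|congr pairing]; apply/funext => x.
  rewrite /matvec [grad (u - v) x](_ : _ = grad u x - grad v x)//.
  by rewrite linearB mulmxBr linearB.
rewrite (_ : fval (u - v) x = fval u x - fval v x)//.
rewrite (_ : dot (b x) (grad (u - v) x) = dot (b x) (grad u x) - dot (b x) (grad v x)).
  by rewrite mulrBr; ring.
rewrite -sumrB; apply: eq_bigr => i _.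
by rewrite -mulrBr; congr (_ * _); rewrite !mxE.
Qed.

Lemma lformB (GD GN : set 'rV[R]_d) f1 f2 psi u v :
  boundary_partition Omega GD GN ->
  L2 volume Omega f1 -> L2v Omega f2 -> L2 surface GN psi ->
  H1 Omega u -> H1 Omega v ->
  lform Omega GN f1 f2 psi (u - v) =
  lform Omega GN f1 f2 psi u - lform Omega GN f1 f2 psi v.
Proof.
move=> [_ rGN _ bE _] Lf1 Lf2 Lpsi [Lu Gu _ [Tu _]] [Lv Gv _ [Tv _]].
have mGN := relatively_open_measurable rGN.
have GNb : GN `<=` boundary Omega.
  by rewrite bE => x GNx; right; exact: subset_closure.
(* Traces are square-integrable on the whole boundary, whereas [psi] lives on [GN] only. *)
have sub h : L2 surface (boundary Omega) h -> L2 surface GN h.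
  move=> Lh; have Ih := L2_sqr_integrable Lh.
  apply: (le_sqr_L2 mGN _ (integrableS (boundary_measurable Omega) mGN GNb Ih)) => //.
  exact: measurable_funS (boundary_measurable Omega) GNb (proj1 Lh).
have E := f_equal2 +%R (f_equal2 +%R (pairingBr mO Lu Lv Lf1)
    (f_equal -%R (vpairingBr Gu Gv Lf2)))
  (f_equal -%R (pairingBr mGN (sub _ Tu) (sub _ Tv) Lpsi)).
by etransitivity; [exact E|rewrite /lform; ring].
Qed.

Lemma normal_fluxE (GD GN : set 'rV[R]_d) f1 f2 psi u div_sigma zd :
  bounded_set Omega -> boundary_partition Omega GD GN ->
  L2 volume Omega f1 -> L2v Omega f2 -> L2 surface GN psi ->
  H1 Omega u -> H1 Omega zd ->
  (forall s0, H1D Omega GD s0 ->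
     bform Omega A b c u s0 = lform Omega GN f1 f2 psi s0) ->
  weak_divergence Omega (flux A f2 u) div_sigma ->
  normal_flux Omega GN psi (flux A f2 u) div_sigma zd =
  lform Omega GN f1 f2 psi zd - bform Omega A b c u zd.
Proof.
move=> bO [_ rGN _ bE _] Lf1 Lf2 Lpsi Hu Hz weak_u [_ Ldiv divE].
have Lq := lower_order_L2 Hu.
set q := (fun x => _ + _) in Lq.
have [_ Gu _ _] := Hu; have [Lz Gz _ _] := Hz.
have LAu := L2v_matvec LA Gu.
have fluxE G : L2v Omega G -> vpairing Omega (flux A f2 u) G =
    - vpairing Omega (fun x => matvec (A x) (grad u x)) G - vpairing Omega f2 G.
  move=> LG.
  have L0 : L2v Omega (fun=> 0 : 'rV[R]_d).
    by move=> i; under eq_fun do rewrite mxE; exact: L2_cst0.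
  have LN : L2v Omega (fun x => 0 - matvec (A x) (grad u x)) by exact: L2vB.
  have := vpairingBl LN Lf2 LG.
  rewrite (vpairingBl L0 LAu LG).
  rewrite [vpairing _ (fun=> 0) _](_ : _ = 0).
    rewrite sub0r => <-; congr vpairing; apply/funext => x.
    by rewrite sub0r.
  rewrite vpairingE// big1// => i _.
  rewrite (_ : (fun _ => _) = (fun=> 0)); first exact (pairing0l volume mO _).
  by apply/funext => x; rewrite mxE.
have divzE : pairing volume Omega div_sigma (fval zd) =
    pairing volume Omega f1 (fval zd) - pairing volume Omega q (fval zd).
  (* The defect in the expected formula for the divergence. Tested with [phi], the weak divergence
     and the primal equation have the same terms in [A] and [f2], and these cancel. *)
  pose g x := div_sigma x - (f1 x - q x).
  have Lfq := L2B mO Lf1 Lq.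
  have Lg : L2 volume Omega g by exact: (L2B mO Ldiv Lfq).
  have gE h : L2 volume Omega h -> pairing volume Omega g h =
      pairing volume Omega div_sigma h -
      (pairing volume Omega f1 h - pairing volume Omega q h).
    by move=> Lh; rewrite (pairingBl mO Ldiv Lfq Lh) (pairingBl mO Lf1 Lq Lh).
  suff /eqP : pairing volume Omega g (fval zd) = 0.
    by rewrite gE// subr_eq0 => /eqP.
  apply: (pairing_test_eq0 oO bO Lg Hz) => phi tphi.
  have := weak_u _ (test_sobolev_H1D oO bO GD tphi).
  have [[Lphi Gphi _ _] _] := test_sobolev_H1D oO bO GD tphi.
  rewrite gE//.
  have := divE _ tphi; rewrite (fluxE _ Gphi).
  rewrite /bform /lform /= -/q.
  (* The Neumann term drops out, since [test_sobolev phi] has trace 0. *)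
  rewrite [pairing surface GN psi _](_ : _ = 0); last first.
    rewrite pairingC; exact (pairing0l surface (relatively_open_measurable rGN) _).
  rewrite /fval /grad /=; lra.
rewrite /normal_flux divzE (fluxE _ Gz) /lform /bform -/q; ring.
Qed.

End forms.

Theorem theorem4p1 (R : realType) (d : nat) (d_ge2 : (2 <= d)%N)
    (Omega : set 'rV[R]_d) (GD GN : set 'rV[R]_d)
    (A : 'rV[R]_d -> 'M[R]_d) (b : 'rV[R]_d -> 'rV[R]_d) (c : 'rV[R]_d -> R)
    (a0 a1 beta : R)
    (f1 g1 : 'rV[R]_d -> R) (f2 g2 : 'rV[R]_d -> 'rV[R]_d)
    (psi_p psi_d phi_p phi_d : 'rV[R]_d -> R) :
  let a := bform Omega A b c in
  let l := lform Omega GN f1 f2 psi_p in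
  let m := lform Omega GN g1 g2 psi_d in
  let Xp := H1_with_trace Omega GD phi_p in
  let Xd := H1_with_trace Omega GD phi_d in
  bounded_lipschitz_domain Omega ->
  boundary_partition Omega GD GN ->
  Linftym Omega A -> 0 < a0 <= a1 -> elliptic Omega A a0 a1 ->
  Linftyv Omega b -> Linfty volume Omega c ->
  L2 volume Omega f1 -> L2 volume Omega g1 -> L2v Omega f2 -> L2v Omega g2 ->
  L2 surface GN psi_p -> L2 surface GN psi_d ->
  Hhalf_on Omega GD phi_p -> Hhalf_on Omega GD phi_d ->
  inf_sup Omega GD a beta ->
  forall u z : sobolev R d,
  Xp u -> (forall s0, H1D Omega GD s0 -> a u s0 = l s0) ->
  Xd z -> (forall s0, H1D Omega GD s0 -> a s0 z = m s0) ->
  forall (div_sigma : 'rV[R]_d -> R) (zd : sobolev R d),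
  let sigma := flux A f2 u in
  weak_divergence Omega sigma div_sigma -> Xd zd ->
  let gamma := pairing volume Omega g1 (fval u) - vpairing Omega g2 (grad u)
               - pairing surface GN psi_d (trace u)
               + normal_flux Omega GN psi_p sigma div_sigma zd in
  let gamma0 w v := m w + l v - a w v in
  forall w v : sobolev R d, Xp w -> Xd v ->
  gamma - gamma0 w v = a (u - w) (z - v) /\
  forall Ccon : R,
    (forall t s, H1 Omega t -> H1 Omega s ->
       `|a t s| <= Ccon * norm1 Omega t * norm1 Omega s) ->
    `|gamma - gamma0 w v| <= Ccon * norm1 Omega (u - w) * norm1 Omega (z - v).
Proof.
move=> a l m Xp Xd [oO _ _ bO _] part LA _ _ Lb Lc Lf1 Lg1 Lf2 Lg2 Lpp Lpd _ _ _.
move=> u z Xu weak_u Xz weak_z div_sigma zd sigma wdiv Xzd gamma gamma0 w v Xw Xv.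
have [[Hu _] [Hz _] [Hzd _]] := And3 Xu Xz Xzd; have [[Hw _] [Hv _]] := conj Xw Xv.
have Duw : H1D Omega GD (u - w) by exact: H1_with_traceB Xu Xw.
have residual s t : Xd s -> Xd t -> l s - a u s = l t - a u t.
  move=> Xs Xt; have [[Hs _] [Ht _]] := conj Xs Xt.
  have := weak_u _ (H1_with_traceB oO bO Xs Xt).
  rewrite /a /l (bformBr oO LA Lb Lc Hu Hs Ht) (lformB oO part Lf1 Lf2 Lpp Hs Ht); lra.
have fluxE : normal_flux Omega GN psi_p sigma div_sigma zd = l v - a u v.
  rewrite (residual v zd Xv Xzd).
  exact: (normal_fluxE oO LA Lb Lc bO part Lf1 Lf2 Lpp Hu Hzd weak_u wdiv).
have E : gamma - gamma0 w v = a (u - w) (z - v).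
  (* [gamma] is [m u] plus the normal flux, that is, [m u + l v - a u v]. *)
  rewrite /gamma0 {1}/gamma fluxE -/(lform Omega GN g1 g2 psi_d u).
  rewrite /a (bformBr oO LA Lb Lc (proj1 Duw) Hz Hv) -/a weak_z//.
  rewrite /a (bformBl oO LA Lb Lc Hv Hu Hw) -/a.
  by rewrite /m (lformB oO part Lg1 Lg2 Lpd Hu Hw); ring.
split=> // C aC; rewrite E; apply: aC.
- exact: H1B.
- exact: H1B.
Qed.
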